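(* Let $L\ge1$ be fixed, and let $g_L$ be a simple graph over $L$ vertices (with vertex set $[L]$). Let $\mathcal{A}_1,\ldots,\mathcal{A}_L\subset\mathcal{A}$ be $g_L$-independent subalgebras and $a\in\mathcal{A}$ be a self-adjoint random variable with mean $\lambda$ and variance $\sigma^2$. For each $l\in[L]$, let $(a_n^{(l)})_{n\ge1}\subset\mathcal{A}_l$ be free identically distributed copies of $a$, and define $$S_n=\frac{1}{\sqrt n}\sum_{k\in[n]}\Big(\prod_{l\in[L]}a_k^{(l)}-\lambda^L\Big).$$ Then, as $n\to\infty$, $S_n$ converges in $*$-moments to $$\sum_{J\in\mathcal{P}^*(L)}\lambda^{|J^c|}\sigma^{|J|}s_J,$$ where each variable $s_J$ is a semi-circle random variable if the subgraph of $g_L$ generated (induced) by $J$ is the complete graph, and a circular random variable otherwise, and where the collection $(s_J)_{J\in\mathcal{P}^*(L)}$ is $h_L$-independent, $h_L$ being the graph with $$V(h_L)=\mathcal{P}^*(L),\qquad E(h_L)=\{(J_1,J_2):J_1\times J_2\subseteq E(g_L)\}.$$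
   Context: Notation: $[n]=\{1,\dots,n\}$; all graphs are simple and loopless. $(\mathcal{A},\tau)$ is a noncommutative probability space (a unital $*$-algebra with a state $\tau$). The mean of $a$ is $\tau(a)$, its variance is $\tau(a^2)-\tau(a)^2$. $\mathcal{P}^*(L)$ is the collection of nonempty subsets of $[L]$; $J^c=[L]\setminus J$. Products $\prod_{l}a_k^{(l)}$ are taken in increasing order of $l$. $g$-independence: for a loopless graph $g$ with finite vertex set $V$ and edge set $E$, subalgebras $(\mathcal{A}_v)_{v\in V}$ are $g$-independent if (1) for every $(i,j)\in E$, $\mathcal{A}_i,\mathcal{A}_j$ are classically independent (in particular they commute); (2) for every $k\ge1$ and $i\in V^k$ such that for all $j_1<j_2$ with $i_{j_1}=i_{j_2}$ there exists $j_1<j_3<j_2$ with $(i_{j_1},i_{j_3})\notin E$, one has $\tau(a_1\cdots a_k)=0$ for all centered $a_j\in\mathcal{A}_{i_j}$, $j\in[k]$. Random variables are $g$-independent if the ($*$-)subalgebras they generate are. Convergence in $*$-moments of $b_n$ to $z$ means $\tau(b_n^{t_1}\cdots b_n^{t_k})\to\tau(z^{t_1}\cdots z^{t_k})$ for all $k\ge1$, $t\in\{1,*\}^k$ (the limit may live in another noncommutative probability space, whose state is also denoted $\tau$). Semi-circle random variables are self-adjoint and standard (mean $0$, variance $1$). A circular random variable has the $*$-law of $c=\frac{s+\sqrt{-1}\,s'}{\sqrt2}$ with $s,s'$ free standard semi-circle random variables. *)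

(* Defs.v *)
From HB Require Import structures.
From mathcomp Require Import all_boot all_order all_algebra.
From mathcomp Require Import complex.
From mathcomp Require Import all_classical all_reals all_analysis.

Set Implicit Arguments.
Unset Strict Implicit.
Unset Printing Implicit Defensive.

Import Order.TTheory GRing.Theory Num.Theory.
Import numFieldNormedType.Exports.

Local Open Scope classical_set_scope.
Local Open Scope ring_scope.
Local Open Scope complex_scope.

HB.mixin Record Algebra_isStarAlgebra (R : realType) A
    of GRing.Algebra R[i] A := {
  star : A -> A;
  starK : involutive star;
  starD : {morph star : x y / x + y};
  starZ : forall (c : R[i]) (x : A), star (c *: x) = Num.conj c *: star x;
  starM : forall x y : A, star (x * y) = star y * star x
}.

#[short(type="starAlgType")]
HB.structure Definition StarAlgebra (R : realType) :=
  { A of GRing.Algebra R[i] A & Algebra_isStarAlgebra R A }.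

(* The order on R[i] is the partial order for which 0 <= z means that z is a
   nonnegative real; the state is not assumed to be tracial or faithful. *)
HB.mixin Record StarAlgebra_isNCProbSpace (R : realType) A
    of StarAlgebra R A := {
  tau : {scalar A};
  tau1 : tau 1 = 1;
  tau_ge0 : forall x : A, 0 <= tau (star x * x)
}.

#[short(type="ncProbSpaceType")]
HB.structure Definition NCProbSpace (R : realType) :=
  { A of StarAlgebra R A & StarAlgebra_isNCProbSpace R A }.

Record graph (V : Type) := Graph {
  edge :> rel V;
  edge_sym : symmetric edge;
  edge_irr : irreflexive edge
}.

Section NCProbability.
Context {R : realType}.

Definition subalgebra (A : algType R[i]) (S : set A) : Prop :=
  [/\ S 1,
      forall x y, S x -> S y -> S (x + y),
      forall (c : R[i]) x, S x -> S (c *: x) &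
      forall x y, S x -> S y -> S (x * y)].

Definition star_subalgebra (A : starAlgType R) (S : set A) : Prop :=
  subalgebra S /\ forall x, S x -> S (star x).

Definition generated (A : starAlgType R) (X : set A) : set A :=
  smallest (@star_subalgebra A) X.

Definition self_adjoint (A : starAlgType R) (x : A) : Prop := star x = x.

(* A word t in {1, *}^k is a sequence of booleans, true standing for "*". *)
Definition star_word (A : starAlgType R) (x : A) (t : seq bool) : A :=
  \prod_(b <- t) (if b then star x else x).

Section OneSpace.
Variable A : ncProbSpaceType R.
Implicit Types (x y : A) (S T : set A).

Definition nc_mean x : R[i] := tau x.
Definition nc_variance x : R[i] := tau (x ^+ 2) - tau x ^+ 2.

Definition star_moment x (t : seq bool) : R[i] := tau (star_word x t).

Definition classically_independent S T : Prop :=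
  forall x y, S x -> T y -> x * y = y * x /\ tau (x * y) = tau x * tau y.

Definition freely_independent (I : Type) (S : I -> set A) : Prop :=
  forall (k : nat) (i : 'I_k -> I) (a : 'I_k -> A),
    (0 < k)%N ->
    (forall j1 j2 : 'I_k, j2 = j1.+1 :> nat -> i j1 <> i j2) ->
    (forall j, S (i j) (a j) /\ tau (a j) = 0) ->
    tau (\prod_(j < k) a j) = 0.

Definition graph_independent (V : finType) (g : graph V) (S : V -> set A) :
    Prop :=
  (forall i j, g i j -> classically_independent (S i) (S j)) /\
  (forall (k : nat) (i : 'I_k -> V) (a : 'I_k -> A),
    (0 < k)%N ->
    (forall j1 j2 : 'I_k, (j1 < j2)%N -> i j1 = i j2 ->
       exists j3 : 'I_k, [/\ (j1 < j3)%N, (j3 < j2)%N & ~~ g (i j1) (i j3)]) ->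
    (forall j, S (i j) (a j) /\ tau (a j) = 0) ->
    tau (\prod_(j < k) a j) = 0).

(* The moments of the semicircle law of mean 0 and variance 1: the Catalan
   numbers in even degree, 0 in odd degree. *)
Definition semicircle_moment (n : nat) : nat :=
  if odd n then 0%N else ('C(n, n./2) %/ (n./2).+1)%N.

Definition semicircular x : Prop :=
  self_adjoint x /\ forall n : nat, tau (x ^+ n) = (semicircle_moment n)%:R.

End OneSpace.

Definition same_star_law (A B : ncProbSpaceType R) (x : A) (y : B) : Prop :=
  forall t : seq bool, star_moment x t = star_moment y t.

Definition circular (A : ncProbSpaceType R) (x : A) : Prop :=
  exists (B : ncProbSpaceType R) (s s' : B),
    [/\ semicircular s, semicircular s',
        freely_independent (fun b : bool => generated [set if b then s else s'])
      & same_star_law x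
          (((Num.sqrt 2)^-1 : R)%:C *: (s + ('i : R[i]) *: s'))].

(* R[i]^o carries the usual topology of the complex plane, given by the
   modulus; R[i] itself has no canonical topology. *)
Definition cvg_star_moments (A B : ncProbSpaceType R) (b : nat -> A) (z : B) :
    Prop :=
  forall t : seq bool,
    (fun n : nat => star_moment (b n) t : R[i]^o) @ \oo -->
      (star_moment z t : R[i]^o).

End NCProbability.

Definition nonempty_subset (L : nat) := {J : {set 'I_L} | J != finset.set0}.

Section InducedGraph.
Variables (L : nat) (g : graph 'I_L).

Definition induced_complete (J : {set 'I_L}) : Prop :=
  forall i j, i \in J -> j \in J -> i != j -> g i j.

Definition product_edge : rel (nonempty_subset L) :=
  fun J1 J2 => [forall i in val J1, forall j in val J2, g i j].

Lemma product_edge_sym : symmetric product_edge.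
Proof.
suff H J1 J2 : product_edge J1 J2 -> product_edge J2 J1.
  by move=> J1 J2; apply/idP/idP; exact: H.
move=> /'forall_implyP h; apply/'forall_implyP => i iJ.
apply/'forall_implyP => j jJ; rewrite edge_sym.
by have /'forall_implyP := h j jJ; exact.
Qed.

Lemma product_edge_irr : irreflexive product_edge.
Proof.
move=> J; apply/negP => /'forall_implyP h.
have /finset.set0Pn[i iJ] := valP J.
by have /'forall_implyP /(_ i iJ) := h i iJ; rewrite edge_irr.
Qed.

(* Disjointness of J1 and J2 is not required explicitly: it follows from the
   absence of loops in g. *)
Definition product_graph : graph (nonempty_subset L) :=
  Graph product_edge_sym product_edge_irr.

End InducedGraph.

Definition tensor_clt_sum (R : realType) (A : ncProbSpaceType R) (L : nat)
    (a_ : 'I_L -> nat -> A) (lambda : R) (n : nat) : A :=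
  ((Num.sqrt n%:R)^-1 : R)%:C *:
    \sum_(1 <= k < n.+1) (\prod_(l < L) a_ l k - (lambda ^+ L)%:C%:A).

Definition clt_limit (R : realType) (B : ncProbSpaceType R) (L : nat)
    (lambda sigma : R) (s : nonempty_subset L -> B) : B :=
  \sum_(J : nonempty_subset L)
    (lambda ^+ #|finset.setC (val J)| * sigma ^+ #|val J|)%:C *: s J.

(* Main.v *)
(** Write a_k^(l) as its centered part plus lambda and expand the product over l:
    S_n becomes a sum over nonempty J of lambda^|J^c| times a normalized sum of the
    products X_k^J of centered variables, l in J. By multilinearity a *-moment of S_n is
    a combination of sums, over assignments of a tag k to each letter, of moments of words
    in the X_k^J. A tag used once kills the moment, and tag assignments with fewer
    distinct tags than half the length are negligible since moments depend only on the
    coincidence pattern of the tags. So only pairings matter; such a moment is 0 unless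
    crossing pairs are joined in h_L, in which case it factors over the pairs.

    Both sides are then evaluated by the same recursion on the word, a Fock space whose
    states are reduced words of blocks: a letter is either pushed on its block or
    annihilates the top of it. On the CLT side the state consists of the tags met exactly
    once so far. On the limit side it indexes products of Wick polynomials of the s_J,
    which are centered by the one-variable semicircle and circular laws, so that
    h_L-independence kills every nonempty state. *)
Require Import Defs.
From HB Require Import structures.
From mathcomp Require Import all_boot all_order all_algebra.
From mathcomp Require Import complex.
From mathcomp Require Import all_classical all_reals all_analysis.
From mathcomp Require Import zify ring.

Set Implicit Arguments.
Unset Strict Implicit.
Unset Printing Implicit Defensive.

Import Order.TTheory GRing.Theory Num.Theory.
Import numFieldNormedType.Exports.

Local Open Scope classical_set_scope.
Local Open Scope ring_scope.
Local Open Scope complex_scope.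

(** * Reduced words over a graph *)

(** Clause (2) of graph independence kills a centered word in which any two letters at one vertex
    are separated by a letter at a non-adjacent vertex; such a word is called reduced. Moments are
    computed by two moves on words whose letters are polynomials in one variable: split off the mean
    of a letter, or merge two letters at one vertex that commute next to each other. They determine
    all moments from the one-variable laws. The copies have infinitely many vertices (l, k), so this
    calculus runs over an arbitrary [eqType]. Circular variables arise because the star reverses
    products: X^J times its star is a palindrome, whose mean is sigma^(2|J|) for every J, whereas
    X^J times itself has this mean only if J is a clique, and mean 0 otherwise. The state is not
    assumed tracial, so words are read from the right end and new letters act on the left of a
    state. *)

Section ReducedWords.
Variables (V : eqType) (adj : rel V).

(** False exactly when a [v] placed in front of [s] can be commuted through neighbours until it
    meets a [v] of [s]. *)
Fixpoint unreachable (v : V) (s : seq V) : bool :=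
  if s is u :: s' then
    if u == v then false else if adj v u then unreachable v s' else true
  else true.

Fixpoint reduced (s : seq V) : bool :=
  if s is v :: s' then unreachable v s' && reduced s' else true.

Lemma reachable_cat v m s : all (adj v) m -> unreachable v (m ++ v :: s) = false.
Proof.
elim: m => /= [|u m IH]; first by rewrite eqxx.
by case/andP=> -> /IH ->; case: ifP.
Qed.

Lemma not_reduced_cat u v m s :
  all (adj v) m -> reduced (u ++ v :: m ++ v :: s) = false.
Proof.
by move=> am; elim: u => /= [|x u ->]; rewrite ?reachable_cat ?andbF.
Qed.

Lemma reachable_split T v (w : seq (V * T)) :
  ~~ unreachable v [seq x.1 | x <- w] ->
  exists m p w', w = m ++ (v, p) :: w' /\ all (fun x => adj v x.1) m.
Proof.
elim: w => //= -[u p] w IH /=.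
case: eqP => [-> _|_]; first by exists [::], p, w.
case: ifP => // avu /IH[m [q [w' [-> am]]]].
by exists ((u, p) :: m), q, w'; rewrite /= avu.
Qed.

Lemma not_reduced_split T (w : seq (V * T)) :
  ~~ reduced [seq x.1 | x <- w] ->
  exists u v p m q w',
    w = u ++ (v, p) :: m ++ (v, q) :: w' /\ all (fun x => adj v x.1) m.
Proof.
elim: w => //= -[v p] w IH /=.
rewrite negb_and => /orP[/reachable_split[m [q [w' [-> am]]]]|].
  by exists [::], v, p, m, q, w'.
move=> /IH[u [v' [p' [m [q [w' [-> am]]]]]]].
by exists ((v, p) :: u), v', p', m, q, w'.
Qed.

(** This turns the syntactic test into the separation condition of graph independence; the
    separating letter is the first non-neighbour met, since [unreachable] forbids meeting [v] before
    it. *)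
Lemma reduced_nth v0 s j1 j2 :
  reduced s -> (j1 < j2)%N -> (j2 < size s)%N -> nth v0 s j1 = nth v0 s j2 ->
  exists j3, [/\ (j1 < j3)%N, (j3 < j2)%N & ~~ adj (nth v0 s j1) (nth v0 s j3)].
Proof.
elim: s j1 j2 => //= v s IH [|j1] [|j2] //=; last first.
  by case/andP=> _ rs j12 j2s e; have [j3 [? ? ?]] := IH j1 j2 rs j12 j2s e; exists j3.+1.
case/andP=> + _ _; rewrite ltnS => + + e.
elim: s j2 e {IH} => //= u s IH [|j2] /= e; first by rewrite e eqxx.
case: eqP => // _; case: ifP => [avu us js|/negbT navu _ _]; last by exists 1%N.
by have [[|j3] [// ? ? ?]] := IH j2 e us js; exists j3.+2.
Qed.

Lemma reduced_swap u x y s : symmetric adj -> irreflexive adj -> adj x y ->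
  reduced (u ++ x :: y :: s) = reduced (u ++ y :: x :: s).
Proof.
move=> sA iA axy.
have nxy : (x == y) = false by apply: contraTF axy => /eqP->; rewrite iA.
elim: u => [|z u IH] /=.
  by rewrite (eq_sym y) nxy axy (sA y x) axy andbCA.
rewrite IH; congr (_ && _); elim: u {IH} => [|z' u IH] /=; last by rewrite IH.
case: (x =P z) => [<-|_]; first by rewrite axy if_same.
case: (y =P z) => [<-|_]; first by rewrite sA axy.
by case: (adj z x); case: (adj z y).
Qed.

Lemma reduced_swap_cat u x m s : symmetric adj -> irreflexive adj ->
  all (adj x) m -> reduced (u ++ x :: m ++ s) = reduced (u ++ m ++ x :: s).
Proof.
move=> sA iA; elim: m u => //= y m IH u /andP[axy am].
by rewrite reduced_swap // -cat_rcons IH // cat_rcons.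
Qed.

Lemma reduced_catr u s : reduced (u ++ s) -> reduced s.
Proof. by elim: u => //= x u IH /andP[_ /IH]. Qed.

End ReducedWords.

Lemma map_reduced (V V' : eqType) (adj : rel V) (adj' : rel V') (f : V -> V') s :
  {in s &, injective f} -> (forall u v, adj' (f u) (f v) = adj u v) ->
  reduced adj' (map f s) = reduced adj s.
Proof.
move=> + fadj; elim: s => //= v s IH fI.
rewrite IH => [|x y xs ys]; last by apply: fI; rewrite inE ?xs ?ys orbT.
congr (_ && _).
have {}fI : {in s, forall u, (f u == f v) = (u == v)}.
  move=> u us; apply/eqP/eqP => [|->//]; apply: fI; rewrite inE ?us ?eqxx ?orbT //.
elim: s fI {IH} => //= u s IH fI; rewrite fI ?mem_head // fadj IH //.
by move=> x xs; apply: fI; rewrite inE xs orbT.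
Qed.

(** * Words in graph independent variables *)

Section GraphWords.
Context {R : realType} (A : ncProbSpaceType R) (V : eqType) (adj : rel V).
Variable a : V -> A.
Local Notation C := R[i].
Implicit Types (w u t : seq (V * {poly C})).

(** Polynomials in the variable of a vertex are closed under centering and under merging, so both
    moves stay inside words. *)
Definition letter_val (x : V * {poly C}) : A := horner_alg (a x.1) x.2.
Definition word_val w : A := \prod_(x <- w) letter_val x.
Definition centered (x : V * {poly C}) : bool := tau (letter_val x) == 0.
Definition vertices w : seq V := [seq x.1 | x <- w].

Hypothesis a_comm : forall u v : V, adj u v -> a u * a v = a v * a u.
Hypothesis a_indep : forall w, w != [::] -> reduced adj (vertices w) ->
  all centered w -> tau (word_val w) = 0.

Lemma word_val_cat u w : word_val (u ++ w) = word_val u * word_val w.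
Proof. by rewrite /word_val big_cat. Qed.

Lemma word_val_cons x w : word_val (x :: w) = letter_val x * word_val w.
Proof. by rewrite /word_val big_cons. Qed.

Lemma word_val_nil : word_val [::] = 1.
Proof. by rewrite /word_val big_nil. Qed.

Lemma letter_val_comm x y :
  adj x.1 y.1 -> GRing.comm (letter_val x) (letter_val y).
Proof.
have key (b c : A) (p : {poly C}) : GRing.comm b c -> GRing.comm b (horner_alg c p).
  move=> bc; elim/poly_ind: p => [|p d IH]; first by rewrite rmorph0; exact: commr0.
  rewrite rmorphD rmorphM /= horner_algX horner_algC; apply: commrD.
    exact: commrM.
  by rewrite /GRing.comm -scalerAr -scalerAl mulr1 mul1r.
move=> /a_comm xy; rewrite /letter_val; apply: (key); apply: commr_sym.
by apply: (key); rewrite /GRing.comm xy.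
Qed.

Lemma word_val_comm x w :
  all (fun y => adj x.1 y.1) w -> letter_val x * word_val w = word_val w * letter_val x.
Proof.
elim: w => [|y w IH] /=; first by rewrite word_val_nil mulr1 mul1r.
case/andP=> axy /IH e; rewrite word_val_cons mulrA (letter_val_comm axy) -mulrA e.
by rewrite mulrA.
Qed.

Lemma word_val_merge u v p m q t : all (fun x => adj v x.1) m ->
  word_val (u ++ (v, p) :: m ++ (v, q) :: t) = word_val (u ++ (v, p * q) :: m ++ t).
Proof.
move=> am; rewrite !(word_val_cat, word_val_cons); congr (_ * _).
rewrite [X in _ * X]mulrA -(@word_val_comm (v, q)) //.
by rewrite /letter_val /= rmorphM /= !mulrA.
Qed.

Lemma word_val_center u v p t (c := tau (letter_val (v, p))) :
  word_val (u ++ (v, p) :: t) = word_val (u ++ (v, p - c%:P) :: t) + c *: word_val (u ++ t).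
Proof.
rewrite !(word_val_cat, word_val_cons) {1 2}/letter_val /= rmorphB /= horner_algC.
rewrite mulrBl mulrBr -scalerAl mul1r -scalerAr subrK //.
Qed.

Lemma centeredB v p : centered (v, p - (tau (letter_val (v, p)))%:P).
Proof.
rewrite /centered {1}/letter_val /= rmorphB /= horner_algC linearB linearZ /= tau1.
by rewrite mulr1 subrr.
Qed.

(* Centering a letter produces a shorter word, and so does merging two letters of
   one vertex that can be commuted next to each other. *)
Lemma word_ind (P : seq (V * {poly C}) -> Prop) :
  (forall u v p t, P (u ++ t) ->
     P (u ++ (v, p - (tau (letter_val (v, p)))%:P) :: t) -> P (u ++ (v, p) :: t)) ->
  (forall u v p m q t, all (fun x => adj v x.1) m -> P (u ++ (v, p * q) :: m ++ t) ->
     P (u ++ (v, p) :: m ++ (v, q) :: t)) ->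
  (forall w, all centered w -> reduced adj (vertices w) -> P w) ->
  forall w, P w.
Proof.
move=> Pc Pm Pr w; have [n le_wn] := ubnP (size w).
elim: n => // n IH in w le_wn *.
(* Centering a letter does not shorten the word, hence an inner induction on the uncentered suffix
   [t]; only the mean term and the merged word are shorter and call the outer one. *)
have key t u : all centered u -> (size (u ++ t) < n.+1)%N -> P (u ++ t).
  elim: t u => [|[v p] t IHt] u cu.
    rewrite cats0 => su; have [ru|nru] := boolP (reduced adj (vertices u)).
      exact: Pr.
    have [u' [v [p [m [q [t [e am]]]]]]] := not_reduced_split nru.
    rewrite e; apply: Pm => //; apply: IH; move: su; rewrite e !size_cat /= !size_cat /=.
    by rewrite !addnS.
  move=> sz; apply: Pc.
    by apply: IH; move: sz; rewrite !size_cat /= addnS.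
  rewrite -cat_rcons; apply: IHt; last by rewrite cat_rcons; move: sz; rewrite !size_cat.
  by rewrite all_rcons cu centeredB.
exact: (key w [::]).
Qed.

(** Only the letters at vertices in [P] are constrained. Moves on the other letters leave the
    [P]-subword alone, two letters in [P] never merge because that subword is reduced, and a
    centered letter has no mean to split off. *)
Lemma tau_reduced_sub (P : pred V) w :
  all (fun x => P x.1 ==> centered x) w ->
  reduced adj [seq v <- vertices w | P v] -> has P (vertices w) -> tau (word_val w) = 0.
Proof.
elim/word_ind: w => [u v p t IH1 IH2|u v p m q t am IH|w cw rw _ _ hw].
- rewrite /vertices !(all_cat, map_cat, filter_cat, has_cat) /=.
  case/and3P=> cu cv ct rr hh; rewrite word_val_center linearD linearZ /=.
  move: IH1 IH2; rewrite /vertices !(all_cat, map_cat, filter_cat, has_cat) /=.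
  rewrite cu ct /= centeredB implybT => IH1 IH2.
  move: cv rr hh IH1 IH2; case: (boolP (P v)) => Pv /= => [/eqP cv|_] rr hh IH1 IH2.
    by rewrite IH2 // cv mul0r addr0.
  by rewrite IH1 // IH2 // mulr0 addr0.
- rewrite /vertices !(all_cat, map_cat, filter_cat, has_cat) /=.
  rewrite !(all_cat, map_cat, filter_cat, has_cat) /=.
  case/and5P=> cu cv cm _ ct rr hh; rewrite word_val_merge //.
  have am' : all (adj v) [seq x <- [seq x.1 | x <- m] | P x].
    by rewrite all_filter all_map; apply/allP => x /(allP am) /= ->; rewrite implybT.
  have Pv : P v = false.
    by apply/negP => Pv; rewrite Pv /= not_reduced_cat in rr.
  rewrite Pv in cv rr hh; apply: IH.
  + by rewrite all_cat /= all_cat cu cm ct Pv.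
  + by rewrite /vertices map_cat filter_cat /= Pv map_cat filter_cat.
  + by rewrite /vertices map_cat has_cat /= Pv map_cat has_cat.
- by apply: a_indep => //; apply: contraTneq hw => ->.
Qed.

(** Both sides respect the two moves applied to [y], which leaves [y] centered and reduced; unless
    [y] is empty both sides then vanish, the left one by [tau_reduced_sub]. *)
Lemma tau_factor (P : pred V) u y t :
  all P (vertices y) -> ~~ has P (vertices u) -> ~~ has P (vertices t) ->
  tau (word_val (u ++ y ++ t)) = tau (word_val y) * tau (word_val (u ++ t)).
Proof.
move=> + nu nt; elim/word_ind: y => [y1 v p y2 IH1 IH2|y1 v p m q y2 am IH|y cy ry Py].
- rewrite /vertices map_cat all_cat /= => /and3P[P1 Pv P2].
  move: IH1 IH2; rewrite /vertices !map_cat !all_cat /= P1 Pv P2 /=.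
  rewrite -!catA !cat_cons !(catA u) => IH1 IH2.
  rewrite word_val_center (word_val_center y1) !linearD !linearZ /= mulrDl -mulrA.
  by rewrite IH2 // IH1.
- rewrite /vertices map_cat all_cat /= map_cat all_cat /= => /and5P[P1 Pv Pm _ P2].
  move: IH; rewrite /vertices map_cat all_cat /= map_cat all_cat P1 Pv Pm P2 /=.
  rewrite -!catA !cat_cons -!catA !cat_cons !(catA u) => IH.
  by rewrite !word_val_merge // IH.
- have [->|y0] := eqVneq y [::]; first by rewrite word_val_nil tau1 mul1r.
  rewrite (a_indep y0 ry cy) mul0r; apply: (@tau_reduced_sub P).
  + rewrite !all_cat; apply/and3P; split.
    * by apply/allP => x xu; rewrite (negPf (hasPn nu _ (map_f _ xu))).
    * by apply/allP => x xy; rewrite (allP cy) // implybT.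
    * by apply/allP => x xt; rewrite (negPf (hasPn nt _ (map_f _ xt))).
  + rewrite /vertices !map_cat !filter_cat.
    move/hasPn: nu => nu; move/hasPn: nt => nt.
    have -> : [seq x <- [seq x.1 | x <- u] | P x] = [::].
      by apply/eqP; rewrite -(negbK (_ == _)) -has_filter; apply/hasPn.
    have -> : [seq x <- [seq x.1 | x <- t] | P x] = [::].
      by apply/eqP; rewrite -(negbK (_ == _)) -has_filter; apply/hasPn.
    by rewrite cats0 /= (all_filterP Py).
  + rewrite /vertices !map_cat !has_cat; case: y y0 Py {cy ry} => //= x y _ /andP[-> _].
    by rewrite orbT.
Qed.

(** The two moves commute with a relabelling that keeps adjacency and the one-variable laws, so a
    moment sees only the coincidence pattern of its vertices. *)
Lemma tau_relabel (f : V -> V) w :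
  (forall u v : V, adj (f u) (f v) = adj u v) ->
  (forall v p, tau (letter_val (f v, p)) = tau (letter_val (v, p))) ->
  {in vertices w &, injective f} ->
  tau (word_val [seq (f x.1, x.2) | x <- w]) = tau (word_val w).
Proof.
move=> fadj ftau.
elim/word_ind: w => [u v p t IH1 IH2 fI|u v p m q t am IH fI|w cw rw fI].
- rewrite map_cat /= word_val_center (word_val_center u) !linearD !linearZ /= ftau.
  rewrite -map_cat IH1; last first.
    by apply: sub_in2 fI => x; rewrite /vertices !map_cat !mem_cat inE => /orP[] ->; rewrite ?orbT.
  by rewrite -IH2 ?map_cat //; apply: sub_in2 fI => x; rewrite /vertices !map_cat.
- rewrite map_cat /= map_cat /= word_val_merge; last first.
    by rewrite all_map; apply: sub_all am => x /=; rewrite fadj.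
  rewrite word_val_merge // -IH; first by rewrite map_cat /= map_cat.
  apply: sub_in2 fI => x; rewrite /vertices !map_cat !mem_cat /= !map_cat !inE !mem_cat inE.
  by case/or4P=> ->; rewrite ?orbT.
- have [->//|w0] := eqVneq w [::].
  rewrite !a_indep //.
  + by rewrite -size_eq0 size_map size_eq0.
  + rewrite -(map_reduced fI fadj) in rw; move: rw.
    by rewrite /vertices -!map_comp.
  + by rewrite all_map; apply: sub_all cw => -[v p]; rewrite /centered /= ftau.
Qed.

End GraphWords.

(** * Independence of the copies *)

Lemma reduced_catl (V : eqType) (adj : rel V) s t : reduced adj (s ++ t) -> reduced adj s.
Proof.
elim: s => //= v s IH /andP[vs /IH->]; rewrite andbT.
by elim: s vs {IH} => //= u s IH; case: ifP => //; case: ifP.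
Qed.

Lemma reduced_swap_cats (V : eqType) (adj : rel V) u s m t :
  symmetric adj -> irreflexive adj -> {in s, forall x, all (adj x) m} ->
  reduced adj (u ++ s ++ m ++ t) = reduced adj (u ++ m ++ s ++ t).
Proof.
move=> sA iA; elim/last_ind: s t => [//|s x IH] t am.
rewrite !cat_rcons -(IH (x :: t)) => [|y ys]; last by apply: am; rewrite mem_rcons inE ys orbT.
rewrite !(catA u) reduced_swap_cat //.
by apply: am; rewrite mem_rcons mem_head.
Qed.

Section Independence.
Context {R : realType} (A : ncProbSpaceType R).
Local Notation C := R[i].

Lemma horner_subalgebra (S : set A) x (p : {poly C}) :
  subalgebra S -> S x -> S (horner_alg x p).
Proof.
case=> S1 SD SZ SM Sx; elim/poly_ind: p => [|p c IH].
  by rewrite rmorph0 -(scale0r 1); exact: SZ.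
rewrite rmorphD rmorphM /= horner_algX horner_algC.
by apply: SD; [exact: SM|exact: SZ].
Qed.

Lemma generated_subalgebra (X : set A) : star_subalgebra (generated X).
Proof.
split; first split.
- by move=> S [[[S1 _ _ _] _] _].
- by move=> x y Gx Gy S hS; have [[[_ SD _ _] _] _] := hS; apply: SD; [exact: Gx|exact: Gy].
- by move=> c x Gx S hS; have [[[_ _ SZ _] _] _] := hS; apply: SZ; exact: Gx.
- by move=> x y Gx Gy S hS; have [[[_ _ _ SM] _] _] := hS; apply: SM; [exact: Gx|exact: Gy].
- by move=> x Gx S hS; have [[_ Sst] _] := hS; apply: Sst; exact: Gx.
Qed.

Lemma generated_set1 x : generated [set x] (x : A).
Proof. by move=> S [_]; apply. Qed.

Lemma graph_independent_seq (V : finType) (g : graph V) (S : V -> set A) (w : seq (V * A)) :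
  graph_independent g S -> w != [::] -> reduced g [seq x.1 | x <- w] ->
  {in w, forall x, S x.1 x.2 /\ tau x.2 = 0} -> tau (\prod_(x <- w) x.2) = 0.
Proof.
case: w => // x0 w; set w' := x0 :: w => -[_ gS] _ rw Sw.
rewrite (big_nth x0) big_mkord.
apply: (gS _ (fun j : 'I_(size w') => (nth x0 w' j).1)) => // [j1 j2 j12 e|j]; last first.
  by apply: Sw; apply: mem_nth.
have sz j : (j < size w')%N -> (nth x0 w' j).1 = nth x0.1 [seq x.1 | x <- w'] j.
  by move=> jw; rewrite (nth_map x0).
rewrite !sz // in e.
have j2s : (j2 < size [seq x.1 | x <- w'])%N by rewrite size_map.
have [j3 [h1 h2 h3]] := reduced_nth rw j12 j2s e.
exists (Ordinal (ltn_trans h2 (ltn_ord j2))); split => //.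
by rewrite !sz //=; apply: ltn_trans h2 _.
Qed.

Lemma freely_independent_seq (I : eqType) (S : I -> set A) (w : seq (I * A)) :
  freely_independent S -> w != [::] -> sorted (fun x y => x != y) [seq x.1 | x <- w] ->
  {in w, forall x, S x.1 x.2 /\ tau x.2 = 0} -> tau (\prod_(x <- w) x.2) = 0.
Proof.
case: w => // x0 w; set w' := x0 :: w => fS _ aw Sw.
rewrite (big_nth x0) big_mkord.
apply: (fS _ (fun j : 'I_(size w') => (nth x0 w' j).1)) => // [j1 j2 j12|j]; last first.
  by apply: Sw; apply: mem_nth.
have sz j : (j < size w')%N -> (nth x0 w' j).1 = nth x0.1 [seq x.1 | x <- w'] j.
  by move=> jw; rewrite (nth_map x0).
rewrite !sz //; apply/eqP; rewrite j12.
move/(sortedP x0.1): aw; apply; rewrite size_map -j12; exact: ltn_ord.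
Qed.

End Independence.

Section Copies.
Context {R : realType} (A : ncProbSpaceType R) (L : nat) (g : graph 'I_L).
Variables (A_ : 'I_L -> set A) (b : 'I_L -> nat -> A).
Hypothesis A_sub : forall l, subalgebra (A_ l).
Hypothesis A_indep : graph_independent g A_.
Hypothesis b_mem : forall l n, A_ l (b l n).
Hypothesis b_free : forall l, freely_independent (fun n => generated [set b l n]).
Local Notation C := R[i].

(** As [g] has no loops, copies of one [l] are never adjacent: freeness is independence over an
    edgeless graph. *)
Definition copy_adj : rel ('I_L * nat) := fun x y => g x.1 y.1.
Local Notation bv := (fun x : 'I_L * nat => b x.1 x.2).

Lemma copy_adj_sym : symmetric copy_adj.
Proof. by move=> x y; apply: edge_sym. Qed.

Lemma copy_adj_irr : irreflexive copy_adj.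
Proof. by move=> x; apply: edge_irr. Qed.

Lemma copy_comm x y : copy_adj x y -> bv x * bv y = bv y * bv x.
Proof.
by move=> xy; have [gA _] := A_indep; have [] := gA _ _ xy _ _ (b_mem x.1 x.2) (b_mem y.1 y.2).
Qed.

(** Inside one [l] there are no edges, so a reduced word is an alternating one and freeness
    applies. *)
Lemma block_centered (l : 'I_L) (s : seq (nat * {poly C})) :
  let w := [seq ((l, y.1), y.2) | y <- s] in
  s != [::] -> reduced copy_adj (vertices w) -> all (centered bv) w ->
  tau (word_val bv w) = 0.
Proof.
move=> w s0 rw cw.
have e : word_val bv w =
    \prod_(x <- [seq (y.1, horner_alg (b l y.1) y.2) | y <- s]) x.2.
  by rewrite /word_val !big_map.
rewrite e; apply: (freely_independent_seq (@b_free l)).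
- by rewrite -size_eq0 size_map size_eq0.
- move: rw; rewrite /w /vertices -!map_comp /=.
  case: s {s0 cw e w} => //= y s; elim: s y => //= z s IH y.
  case/andP=> + rs; rewrite (IH z) ?rs // andbT.
  by case: eqP => //= nzy _; apply/eqP => e; apply: nzy; rewrite e.
- move=> x /mapP[y ys ->] /=; split.
    have [Gs _] := generated_subalgebra [set b l y.1].
    by apply: (horner_subalgebra _ Gs); apply: generated_set1.
  move/allP: cw => /(_ ((l, y.1), y.2)).
  by rewrite (map_f (fun y => ((l, y.1), y.2))) // => /(_ isT)/eqP.
Qed.

Lemma block_mem (l : 'I_L) (s : seq (nat * {poly C})) :
  A_ l (word_val bv [seq ((l, y.1), y.2) | y <- s]).
Proof.
have [S1 _ _ SM] := A_sub l; elim: s => [|y s IH] /=; first by rewrite word_val_nil.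
by rewrite word_val_cons; apply: SM => //; apply: horner_subalgebra.
Qed.

Definition block_word (bs : seq ('I_L * seq (nat * {poly C}))) :=
  flatten [seq [seq ((x.1, y.1), y.2) | y <- x.2] | x <- bs].

Lemma tau_block_word bs : bs != [::] -> all (fun x => x.2 != [::]) bs ->
  reduced copy_adj (vertices (block_word bs)) -> all (centered bv) (block_word bs) ->
  tau (word_val bv (block_word bs)) = 0.
Proof.
have [n] := ubnP (size bs); elim: n => // n IH in bs * => sz bs0 ne rb cb.
have [rg|nrg] := boolP (reduced g [seq x.1 | x <- bs]).
  have -> : word_val bv (block_word bs) =
      \prod_(x <- [seq (x.1, word_val bv [seq ((x.1, y.1), y.2) | y <- x.2]) | x <- bs]) x.2.
    rewrite big_map; elim: (bs) => [|x s IHs]; first by rewrite word_val_nil big_nil.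
    by rewrite /block_word /= word_val_cat big_cons -IHs.
  apply: (graph_independent_seq A_indep).
  - by rewrite -size_eq0 size_map size_eq0.
  - by rewrite -map_comp.
  - move=> _ /mapP[x xb ->] /=; split; first exact: block_mem.
    move: rb cb ne; case/splitPr: xb => u t.
    rewrite /block_word map_cat flatten_cat /= /vertices !map_cat.
    move=> /reduced_catr/reduced_catl rx; rewrite !all_cat /= => /and3P[_ cx _] /and3P[_ x0 _].
    exact: block_centered.
(* Forgetting the tags can destroy reducedness: two blocks of [l] are then separated only by
   neighbours of [l]. Moving [s2] next to [s1] keeps the word reduced for [copy_adj] and lowers the
   number of blocks. *)
have [u [l [s1 [m [s2 [t [e am]]]]]]] := not_reduced_split nrg.
have am' : {in [seq (l, y.1) | y <- s2], forall x, all (copy_adj x) (vertices (block_word m))}.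
  move=> _ /mapP[y _ ->]; rewrite /vertices all_map /block_word.
  elim: m am {e} => //= x m IHm /andP[gx /IHm]; rewrite all_cat => ->.
  by rewrite andbT all_map; apply/allP.
have comm : word_val bv (block_word m) * word_val bv [seq ((l, y.1), y.2) | y <- s2]
    = word_val bv [seq ((l, y.1), y.2) | y <- s2] * word_val bv (block_word m).
  elim: s2 am' {e} => [|y s IHs] am' /=; first by rewrite word_val_nil mulr1 mul1r.
  rewrite word_val_cons mulrA -(word_val_comm copy_comm); last first.
    by have := am' _ (mem_head _ _); rewrite /vertices all_map.
  by rewrite -mulrA IHs ?mulrA // => x xs; apply: am'; rewrite inE xs orbT.
have e1 : block_word bs = block_word u ++ [seq ((l, y.1), y.2) | y <- s1] ++
    block_word m ++ [seq ((l, y.1), y.2) | y <- s2] ++ block_word t.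
  by rewrite e /block_word map_cat /= map_cat flatten_cat /= flatten_cat.
have e2 : block_word (u ++ (l, s1 ++ s2) :: m ++ t) = block_word u ++
    [seq ((l, y.1), y.2) | y <- s1] ++ [seq ((l, y.1), y.2) | y <- s2] ++
    block_word m ++ block_word t.
  by rewrite /block_word !map_cat /= !map_cat !flatten_cat /= !flatten_cat -!catA.
have -> : word_val bv (block_word bs) = word_val bv (block_word (u ++ (l, s1 ++ s2) :: m ++ t)).
  rewrite e1 e2 !word_val_cat; congr (_ * (_ * _)).
  by rewrite [LHS]mulrA comm mulrA.
apply: IH.
- by move: sz; rewrite e !size_cat /= !size_cat /= !addnS.
- by case: (u).
- move: ne; rewrite e !all_cat /= !all_cat /= => /and5P[-> s10 -> _ ->].
  by rewrite andbT; case: (s1) s10.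
- move: rb; rewrite e1 e2 /vertices !map_cat !catA -!map_cat -!catA !map_cat.
  rewrite !(catA [seq x.1 | x <- block_word u]) -reduced_swap_cats //.
  + exact: copy_adj_sym.
  + exact: copy_adj_irr.
  + by rewrite -map_comp; exact: am'.
- by move: cb; rewrite e1 e2 !all_cat => /and5P[-> -> -> -> ->].
Qed.

(* A word in the variables b l k is a word of one-letter blocks; blocks of one algebra
   A_ l that commute next to each other merge into an alternating product of free
   variables, which is centered. *)
Lemma copies_indep (w : seq (('I_L * nat) * {poly C})) : w != [::] ->
  reduced copy_adj (vertices w) -> all (centered bv) w -> tau (word_val bv w) = 0.
Proof.
move=> w0 rw cw; set bs := [seq (x.1.1, [:: (x.1.2, x.2)]) | x <- w].
have e : block_word bs = w.
  by rewrite /bs /block_word; elim: (w) => //= -[[l k] p] s ->.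
rewrite -e; apply: tau_block_word; rewrite ?e //.
  by rewrite -size_eq0 size_map size_eq0.
by rewrite all_map; apply/allP.
Qed.

End Copies.

(** * Blocks and the Fock recursion *)

Section Blocks.
Variables (V : eqType) (h : rel V).
Hypotheses (h_sym : symmetric h) (h_irr : irreflexive h).

Section Payload.
Variable T : eqType.
Implicit Types (bs : seq (V * seq T)) (v : V) (r : seq T).

Definition block_vertices bs : seq V := [seq x.1 | x <- bs].

(** The head of [r] is the top of the block. An emptied block disappears, so the empty list also
    stands for a block that does not exist yet. *)
Definition add_block v r bs := if r is [::] then bs else (v, r) :: bs.

Fixpoint find_block v bs : seq (V * seq T) * seq T * seq (V * seq T) :=
  if bs is x :: bs' then
    if x.1 == v then ([::], x.2, bs')
    else let: (ab, r, be) := find_block v bs' in (x :: ab, r, be)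
  else ([::], [::], [::]).

(** Splits the state around the block that [v] can reach; if there is none, the default is an empty
    block in front of everything, where a creation opens a new block. *)
Definition locate v bs :=
  if unreachable h v (block_vertices bs) then ([::], [::], bs) else find_block v bs.

Definition normal bs := all (fun x => x.2 != [::]) bs && reduced h (block_vertices bs).

Lemma find_blockP v bs ab r be : normal bs -> ~~ unreachable h v (block_vertices bs) ->
  find_block v bs = (ab, r, be) ->
  [/\ bs = ab ++ (v, r) :: be, all (fun x => h v x.1) ab,
      unreachable h v (block_vertices be) & r != [::]].
Proof.
case/andP; elim: bs ab r be => //= x bs IH ab r be /andP[x0 ne] /andP[ux rb].
case: eqP ux => [<- ux _ [<- <- <-]|_ ux]; first by split=> //=; case: (x).
case: ifP => // hvx nu; case e: find_block => [[ab' r'] be'] [<- <- <-].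
by have [-> ? ? ?] := IH _ _ _ ne rb nu e; split => //=; rewrite hvx.
Qed.

Lemma locateP v bs ab r be : normal bs -> locate v bs = (ab, r, be) ->
  [/\ bs = ab ++ add_block v r be, all (fun x => h v x.1) ab,
      unreachable h v (block_vertices be) & r = [::] -> ab = [::]].
Proof.
move=> nb; rewrite /locate; case: ifP => [ur [<- <- <-] //|/negbT nu e].
by have [-> ? ? r0] := find_blockP nb nu e; case: r r0 {e}.
Qed.

Lemma normal_push v e bs ab r be : normal bs -> locate v bs = (ab, r, be) ->
  normal (ab ++ (v, e :: r) :: be).
Proof.
move=> nb loc; have [eb _ ur r0] := locateP nb loc; move: nb; rewrite eb /normal.
case: r r0 {loc eb} => [/(_ erefl) ->|e' r _] /=; first by move=> /andP[-> ->]; rewrite ur.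
by rewrite !all_cat /block_vertices !map_cat.
Qed.

(** When the block of [v] empties, it is commuted to the front past [ab], where removing it keeps
    the word reduced. *)
Lemma normal_pop v e bs ab r be : normal bs -> locate v bs = (ab, e :: r, be) ->
  normal (ab ++ add_block v r be).
Proof.
move=> nb loc; have [eb aab ur _] := locateP nb loc; move: nb; rewrite eb /normal.
case: r {loc eb} => [|e' r] /=; rewrite !all_cat /block_vertices !map_cat //=.
move=> /andP[-> /=]; rewrite -(@reduced_swap_cat _ h [::]) ?all_map //.
by move=> /andP[].
Qed.

Definition flat bs : seq (V * T) := flatten [seq [seq (x.1, y) | y <- x.2] | x <- bs].

Lemma flat_cat bs1 bs2 : flat (bs1 ++ bs2) = flat bs1 ++ flat bs2.
Proof. by rewrite /flat map_cat flatten_cat. Qed.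

Lemma flat_cons x bs : flat (x :: bs) = [seq (x.1, y) | y <- x.2] ++ flat bs.
Proof. by []. Qed.

Lemma flat_add_block v r bs : flat (add_block v r bs) = [seq (v, y) | y <- r] ++ flat bs.
Proof. by case: r. Qed.

Lemma flat_eq0 bs : normal bs -> (flat bs == [::]) = (bs == [::]).
Proof. by case/andP; case: bs => //= -[v [|y r]] bs. Qed.

Lemma unreachable_flat v bs : normal bs ->
  unreachable h v (block_vertices bs) -> unreachable h v [seq y.1 | y <- flat bs].
Proof.
case/andP=> + _; elim: bs => //= -[u [//|y r]] bs IH /= ne.
case: (u =P v) => // /eqP nuv.
rewrite map_cat -map_comp; case hvu: (h v u) => // /(IH ne) ur.
by elim: r => //= z r IHr; rewrite (negPf nuv) hvu.
Qed.

Lemma all_flat (P : pred V) bs :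
  all (fun x => P x.1) bs -> all (fun y => P y.1) (flat bs).
Proof.
elim: bs => //= x bs IH /andP[Px /IH]. rewrite flat_cons all_cat => ->.
by rewrite andbT all_map; apply/allP.
Qed.

End Payload.

Section Erase.
Variables (T T' : eqType) (f : T -> T').

Definition map_blocks (bs : seq (V * seq T)) : seq (V * seq T') :=
  [seq (x.1, map f x.2) | x <- bs].

Lemma map_blocks_cat bs1 bs2 :
  map_blocks (bs1 ++ bs2) = map_blocks bs1 ++ map_blocks bs2.
Proof. exact: map_cat. Qed.

Lemma map_add_block v r bs :
  map_blocks (add_block v r bs) = add_block v (map f r) (map_blocks bs).
Proof. by case: r. Qed.

Lemma locate_map v bs : locate v (map_blocks bs) =
  let: (ab, r, be) := locate v bs in (map_blocks ab, map f r, map_blocks be).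
Proof.
have e : block_vertices (map_blocks bs) = block_vertices bs.
  by rewrite /block_vertices -map_comp.
rewrite /locate e; case: ifP => _ //.
elim: bs {e} => //= x bs ->; case: ifP => // _.
by case: find_block => [[]].
Qed.

End Erase.

(* The vacuum moment of a product of letters acting on a Fock space whose basis states
   are the normal forms of words: a letter is created on top of its reachable block, or
   it annihilates the top of that block. The n-th creation is weighted by fresh n. *)
Section Fock.
Variables (K : comRingType) (compl : pred V) (fresh : nat -> K).

Definition matches v (e e' : bool) := compl v || (e != e').

Fixpoint fock n (bs : seq (V * seq bool)) (w : seq (V * bool)) : K :=
  if w is x :: w' then
    let: (ab, r, be) := locate x.1 bs in
    fresh n * fock n.+1 (ab ++ (x.1, x.2 :: r) :: be) w' +
    (if r is e :: r' then
       if matches x.1 x.2 e then fock n (ab ++ add_block x.1 r' be) w' else 0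
     else 0)
  else (bs == [::])%:R.

End Fock.
End Blocks.

Lemma size_flat_add (V T : eqType) (bs : seq (V * seq T)) v r :
  size (flat (add_block v r bs)) = (size r + size (flat bs))%N.
Proof. by rewrite flat_add_block size_cat size_map. Qed.

(** * Tag sequences and pairings *)

Fixpoint tag_seqs (n m : nat) : seq (seq nat) :=
  if m is m'.+1 then [seq k :: ks | k <- iota 0 n, ks <- tag_seqs n m'] else [:: [::]].

Definition pairing (t : seq nat) : bool := all (fun k => count_mem k t == 2) t.

Lemma perm_pairing t t' : perm_eq t t' -> pairing t = pairing t'.
Proof.
move=> e; rewrite /pairing (perm_all _ e); apply: eq_all => k.
by move/permP: e => ->.
Qed.

Section TagLists.
Implicit Types (T U ks : seq nat) (k : nat).

(** In these lemmas [T] lists the tags met once, [U] the tags met twice, hence written twice, and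
    [ks] the tags still to come; the concatenation is a pairing when the full tag sequence is
    one. *)
Lemma perm_push_tag T T' U ks k : perm_eq T' (k :: T) ->
  perm_eq (T ++ U ++ U ++ k :: ks) (T' ++ U ++ U ++ ks).
Proof.
move=> /permP e; apply/permP => p; move: (e p).
by rewrite !count_cat /= => ->; clear; lia.
Qed.

Lemma perm_pop_tag T T' U ks k : perm_eq T (k :: T') ->
  perm_eq (T ++ U ++ U ++ k :: ks) (T' ++ (k :: U) ++ (k :: U) ++ ks).
Proof.
move=> /permP e; apply/permP => p; move: (e p).
by rewrite !count_cat /= => ->; clear; lia.
Qed.

Lemma perm_pop_used T T' U k : perm_eq T (k :: T') -> perm_eq (T ++ U) (T' ++ k :: U).
Proof.
move=> /permP e; apply/permP => p; move: (e p).
by rewrite !count_cat /= => ->; clear; lia.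
Qed.

Lemma pairing_closed_tag T U ks k : k \in U -> pairing (T ++ U ++ U ++ k :: ks) = false.
Proof.
move=> kU; apply/negP => /allP/(_ k).
rewrite !mem_cat kU !orbT => /(_ isT); rewrite !count_cat /= eqxx.
have : (0 < count_mem k U)%N by rewrite -has_count has_pred1.
move: (count_mem k T) (count_mem k U) (count_mem k ks) => a b c b0 /eqP.
by move: b0; clear; lia.
Qed.

Lemma pairing_open_tag T U ks j : uniq T -> j \in T ->
  pairing (T ++ U ++ U ++ ks) -> (count_mem j ks <= 1)%N.
Proof.
move=> uT jT /allP/(_ j); rewrite mem_cat jT => /(_ isT).
rewrite !count_cat (count_uniq_mem _ uT) jT => /eqP.
by move: (count_mem j U) (count_mem j ks) => a b; clear; lia.
Qed.

End TagLists.

(** * Limits of complex sequences *)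

Section Limits.
Variable R : realType.
Local Notation C := R[i].
Implicit Types (f g : nat -> C) (a b : C).

Definition tends f a : Prop := (fun n : nat => f n : C^o) @ \oo --> (a : C^o).

Lemma tendsD f g a b : tends f a -> tends g b -> tends (fun n => f n + g n) (a + b).
Proof. exact: cvgD. Qed.

Lemma tendsM f g a b : tends f a -> tends g b -> tends (fun n => f n * g n) (a * b).
Proof. exact: cvgM. Qed.

Lemma tends_cst a : tends (fun=> a) a.
Proof. exact: cvg_cst. Qed.

Lemma tends_eventually N f g a :
  (forall n, (N <= n)%N -> f n = g n) -> tends g a -> tends f a.
Proof.
move=> fg; apply: cvg_trans; apply: near_eq_cvg; exists N => // n /= Nn.
by rewrite fg.
Qed.

Lemma tends_eps f a :
  (forall e : R, 0 < e -> exists N, forall n, (N <= n)%N -> `|f n - a| <= e%:C) -> tends f a.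
Proof.
move=> fa; apply/cvgrPdist_le => -[e e'] /=; rewrite ltcE /= => /andP[/eqP-> e0].
have [N Nf] := fa _ e0; exists N => // n /= /Nf; by rewrite distrC.
Qed.

Lemma tends_sum (I : eqType) (s : seq I) (F : I -> nat -> C) (l : I -> C) :
  {in s, forall i, tends (F i) (l i)} ->
  tends (fun n => \sum_(i <- s) F i n) (\sum_(i <- s) l i).
Proof.
elim: s => [|i s IH] Fl.
  rewrite big_nil; apply: (@tends_eventually 0 _ (fun=> 0)); last exact: tends_cst.
  by move=> n _; rewrite big_nil.
rewrite big_cons; apply: (@tends_eventually 0 _ (fun n => F i n + \sum_(j <- s) F j n)).
  by move=> n _; rewrite big_cons.
apply: tendsD; first exact/Fl/mem_head.
by apply: IH => j js; apply: Fl; rewrite inE js orbT.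
Qed.

Definition root_n (n : nat) : C := (Num.sqrt n%:R : R)%:C.
Definition inv_root (n : nat) : C := ((Num.sqrt n%:R)^-1 : R)%:C.

Lemma inv_rootK n : (0 < n)%N -> inv_root n * root_n n = 1.
Proof.
move=> n0; rewrite /inv_root /root_n -rmorphM /= mulVf // gt_eqF // sqrtr_gt0.
by rewrite ltr0n.
Qed.

Lemma inv_root_sqr n : (0 < n)%N -> inv_root n ^+ 2 * n%:R = 1.
Proof.
move=> n0; rewrite -(rmorph_nat (real_complex R)) /inv_root -rmorphXn -rmorphM /= exprVn.
by rewrite sqr_sqrtr ?ler0n // mulVf // pnatr_eq0 -lt0n.
Qed.

Lemma inv_root_ge0 n : 0 <= inv_root n.
Proof. by rewrite /inv_root ler0c invr_ge0 sqrtr_ge0. Qed.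

Lemma inv_root_le1 n : (0 < n)%N -> inv_root n <= 1.
Proof.
move=> n0; rewrite /inv_root -(rmorph1 (real_complex R)) lecR invf_le1.
  by rewrite -{1}sqrtr1 ler_sqrt ?ler1n ?ler0n.
by rewrite sqrtr_gt0 ltr0n.
Qed.

Lemma tends_inv_root : tends inv_root 0.
Proof.
apply: tends_eps => e e0; pose N := Num.bound (e ^- 2).
have N0 : e ^- 2 < N%:R by apply: archi_boundP; rewrite invr_ge0 exprn_ge0 // ltW.
exists N => n Nn; rewrite subr0 ger0_norm ?inv_root_ge0 // /inv_root lecR.
have n0 : 0 < n%:R :> R.
  by apply: lt_le_trans (_ : N%:R <= _); rewrite ?ler_nat //; apply: le_lt_trans N0;
    rewrite invr_ge0 exprn_ge0 // ltW.
rewrite invf_ple ?posrE ?sqrtr_gt0 //.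
have -> : e^-1 = Num.sqrt (e ^- 2) by rewrite -exprVn sqrtr_sqr ger0_norm // invr_ge0 ltW.
by apply: ler_wsqrtr; apply: le_trans (ltW N0) _; rewrite ler_nat.
Qed.

(** The product is at most c n^(d - m/2), and the exponent is at most -1/2. *)
Lemma tends_bounded_count f (c : C) m d : (d.*2 < m)%N ->
  (forall n, `|f n| <= c * n%:R ^+ d) -> tends (fun n => inv_root n ^+ m * f n) 0.
Proof.
move=> dm fc.
have r0 : tends (fun n => inv_root n * c) 0.
  by rewrite -(mul0r c); apply: tendsM; [exact: tends_inv_root|exact: tends_cst].
have bound n : (0 < n)%N -> `|inv_root n ^+ m * f n| <= inv_root n * c.
  move=> n0; have c0 : 0 <= c.
    have := le_trans (normr_ge0 _) (fc n); rewrite pmulr_lge0 // exprn_gt0 // ltr0n //.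
  rewrite normrM normrX ger0_norm ?inv_root_ge0 //.
  apply: le_trans (_ : inv_root n ^+ m * (c * n%:R ^+ d) <= _).
    by rewrite ler_wpM2l // exprn_ge0 // inv_root_ge0.
  rewrite -(subnK (ltnW dm)) exprD -muln2 mulnC exprM -mulrA [X in _ * X]mulrCA -exprMn.
  rewrite inv_root_sqr // expr1n mulr1 ler_wpM2r //.
  have -> : (m - 2 * d)%N = (m - 2 * d).-1.+1 by rewrite prednK // subn_gt0 mulnC muln2.
  rewrite exprS ler_piMr ?inv_root_ge0 // exprn_ile1 ?inv_root_ge0 //.
  exact: inv_root_le1.
apply: tends_eps => e e0; move/cvgrPdist_le: r0 => /(_ e%:C); rewrite (ltcR 0) => /(_ e0)[N _ Nr].
exists N.+1 => n Nn; rewrite subr0; apply: le_trans (bound n (leq_ltn_trans _ Nn)) _ => //.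
apply: le_trans (real_ler_norm _) _; last by rewrite -normrN -sub0r; apply: Nr; apply: ltnW.
rewrite ger0_real // (le_trans _ (bound n (leq_ltn_trans _ Nn))) //.
Qed.

End Limits.

(** * Limit of the rescaled Fock recursion *)

Section FockLimit.
Variables (R : realType) (V : eqType) (h : rel V) (compl : pred V).
Hypotheses (h_sym : symmetric h) (h_irr : irreflexive h).
Local Notation C := R[i].

Lemma size_flat_add_cons (T : eqType) (bs : seq (V * seq T)) v e r :
  size (flat (add_block v (e :: r) bs)) = (size (flat (add_block v r bs))).+1.
Proof. by rewrite !size_flat_add. Qed.

(** Each unread letter carries n^(-1/2) and each letter of the state n^(1/2). A creation thus costs
    1/n, which its weight n - u compensates in the limit, and an annihilation is neutral. *)
Lemma tends_fock w bs u u' : normal h bs -> 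
  tends (fun n => inv_root R n ^+ size w * root_n R n ^+ size (flat bs) *
      fock h compl (fun j => (n - j)%:R) u bs w)
    (fock h compl (fun=> 1) u' bs w).
Proof.
elim: w bs u u' => [|[v e] w IH] bs u u' nb /=.
  apply: (@tends_eventually _ 0 _ (fun=> (bs == [::])%:R)); last exact: tends_cst.
  move=> n _; rewrite mul1r -(flat_eq0 nb) -size_eq0.
  by case: (size _) => [|m]; rewrite ?mul1r ?mulr0.
case loc: (locate h v bs) => [[ab r] be]; have [eb _ _ _] := locateP nb loc.
have tn : tends (fun n => (n - u)%:R * inv_root R n ^+ 2 : C) 1.
  apply: (@tends_eventually _ u.+1 _ (fun n => 1 + - u%:R * (inv_root R n * inv_root R n))).
    move=> n un; rewrite natrB ?(ltnW un) // mulrBl (mulrC n%:R) inv_root_sqr ?(leq_trans _ un) //.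
    by rewrite expr2 mulNr.
  rewrite -[X in tends _ X]addr0; apply: tendsD; first exact: tends_cst.
  rewrite -[X in tends _ X](mulr0 (- u%:R)) -[X in _ * X](mulr0 0).
  by apply: tendsM; [exact: tends_cst|apply: tendsM; exact: tends_inv_root].
apply: (@tends_eventually _ 1 _ (fun n =>
  ((n - u)%:R * inv_root R n ^+ 2) * (inv_root R n ^+ size w *
    root_n R n ^+ (size (flat bs)).+1 *
    fock h compl (fun j => (n - j)%:R) u.+1 (ab ++ (v, e :: r) :: be) w) +
  (if r is c :: r' then if matches compl v e c then
     inv_root R n ^+ size w * root_n R n ^+ size (flat (ab ++ add_block v r' be)) *
     fock h compl (fun j => (n - j)%:R) u (ab ++ add_block v r' be) w else 0 else 0))).
  move=> n n0; have rq := @inv_rootK R n n0.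
  rewrite mulrDr; congr (_ + _).
    have -> : inv_root R n ^+ (size w).+1 = inv_root R n ^+ size w * inv_root R n ^+ 2 * root_n R n.
      by rewrite -mulrA expr2 -mulrA rq mulr1 exprSr.
    rewrite [root_n R n ^+ _.+1]exprS.
    have ac (K : comRingType) (a0 a1 a2 a3 a4 a5 : K) :
      a0 * a1 * a2 * a3 * (a4 * a5) = a4 * a1 * (a0 * (a2 * a3) * a5) by ring.
    exact: ac.
  case: r {loc} eb => [|c r] eb; first by rewrite mulr0.
  case: ifP => _; last by rewrite mulr0.
  have -> : size (flat bs) = (size (flat (ab ++ add_block v r be))).+1.
    by rewrite eb !flat_cat !(size_cat (flat ab)) size_flat_add_cons addnS.
  rewrite exprSr exprS -[X in X * _]mulrA [X in _ * X * _]mulrA rq mul1r.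
  by [].
apply: tendsD.
  rewrite mul1r -[X in tends _ X]mul1r; apply: tendsM => //.
  have -> : (size (flat bs)).+1 = size (flat (ab ++ (v, e :: r) :: be)).
    by rewrite eb !flat_cat !(size_cat (flat ab)) -[(v, e :: r) :: be]/(add_block v (e :: r) be)
      size_flat_add_cons addnS.
  by apply: IH; exact: normal_push nb loc.
case: r loc {eb} => [|c r] loc; first exact: tends_cst.
case: ifP => _; last exact: tends_cst.
by apply: IH; apply: (normal_pop _ _ nb loc).
Qed.

End FockLimit.

(** * Counting tag sequences with few distinct tags *)

Lemma tag_seqs_uniq n m : uniq (tag_seqs n m).
Proof.
elim: m => //= m IH; apply: allpairs_uniq => //; first exact: iota_uniq.
by move=> [k ks] [k' ks'] _ _ /= [-> ->].
Qed.

Lemma mem_tag_seqs n m ks :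
  (ks \in tag_seqs n m) = (size ks == m) && all (fun k => k < n)%N ks.
Proof.
elim: m ks => [|m IH] [|k ks] //=.
  by apply/allpairsP => -[[k' ks'] /= [_ _]].
apply/allpairsP/and3P => [[[k' ks'] /= [kn + [-> ->]]]|[sk kn lt_n]].
  by rewrite IH => /andP[/eqP-> ->]; move: kn; rewrite mem_iota add0n.
by exists (k, ks); rewrite /= mem_iota add0n IH; split => //; apply/andP.
Qed.

Lemma size_mem_tag_seqs n m ks : ks \in tag_seqs n m -> size ks = m.
Proof. by rewrite mem_tag_seqs => /andP[/eqP]. Qed.

Lemma size_tag_seqs n m : size (tag_seqs n m) = (n ^ m)%N.
Proof. by elim: m => //= m IH; rewrite size_allpairs size_iota IH expnS. Qed.

(* A tag sequence with at most d distinct tags is a tag sequence over [0, d) composed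
   with a list of d tags. *)
Lemma count_few_tags n m d : (0 < m)%N ->
  (size [seq ks <- tag_seqs n m | (size (undup ks) <= d)%N] <= n ^ d * d ^ m)%N.
Proof.
move=> m0; rewrite -!size_tag_seqs -(size_allpairs (fun t p : seq nat => map (nth 0%N t) p)).
apply: uniq_leq_size; first exact/filter_uniq/tag_seqs_uniq.
move=> ks; rewrite mem_filter mem_tag_seqs => /and3P[ud /eqP sk lt_n].
(* The padding to length [d] repeats a tag of [ks], which exists since [0 < m], so that all entries
   stay below [n]. *)
pose t := undup ks ++ nseq (d - size (undup ks)) (head 0%N ks).
have st : size t = d by rewrite size_cat size_nseq subnKC.
have kt k : k \in ks -> k \in t by rewrite mem_cat mem_undup => ->.
apply/allpairsP; exists (t, map (index^~ t) ks) => /=; split.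
- rewrite mem_tag_seqs st eqxx all_cat /=; apply/andP; split.
    by apply/allP => k; rewrite mem_undup => /(allP lt_n).
  apply/allP => k; rewrite mem_nseq => /andP[_ /eqP->].
  by case: (ks) lt_n sk => [_ e|k0 ks' /= /andP[]//]; rewrite -e in m0.
- rewrite mem_tag_seqs size_map sk eqxx all_map /=.
  by apply/allP => k kk /=; rewrite -[X in (_ < X)%N]st index_mem kt.
- rewrite -map_comp -[LHS]map_id; apply/eq_in_map => k kk /=.
  by rewrite nth_index ?kt.
Qed.

Lemma size_count_undup (s : seq nat) : size s = (\sum_(k <- undup s) count_mem k s)%N.
Proof.
rewrite -sum1_size -(big_undup_iterop_count addn s xpredT (fun=> 1%N)).
by apply: eq_bigr => k _; rewrite Monoid.iteropE iter_addn_0 mul1n.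
Qed.

(** Every tag occurs at least twice and, [ks] not being a pairing, some tag at least three times. *)
Lemma few_tags (ks : seq nat) : ~~ pairing ks ->
  all (fun k => count_mem k ks != 1%N) ks -> ((size (undup ks)).*2 < size ks)%N.
Proof.
move=> /allPn[k0 k0s c0] /allP n1; rewrite [X in (_ < X)%N]size_count_undup.
have -> : (size (undup ks)).*2 = (\sum_(k <- undup ks) 2)%N.
  by rewrite big_const_seq count_predT iter_addn_0 mul2n.
have ge2 k : k \in ks -> (2 <= count_mem k ks)%N.
  move=> ks'; move: (n1 k ks') ; have : (0 < count_mem k ks)%N by rewrite -has_count has_pred1.
  by case: (count_mem k ks) => [|[]].
have k0u : k0 \in undup ks by rewrite mem_undup.
rewrite !(bigD1_seq _ k0u (undup_uniq _)) /=.
rewrite -addSn leq_add //; first by rewrite ltn_neqAle eq_sym c0 ge2.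
rewrite [leqLHS]big_seq_cond [leqRHS]big_seq_cond.
by apply: leq_sum => k /andP[+ _]; rewrite mem_undup => /ge2.
Qed.

(** * Moments of products of centered copies *)

Section Items.
Context {R : realType} (A : ncProbSpaceType R) (L : nat) (g : graph 'I_L).
Variables (b : 'I_L -> nat -> A) (lam s2 : R[i]).
Local Notation C := R[i].
Local Notation VJ := (nonempty_subset L).
Local Notation bv := (fun x : 'I_L * nat => b x.1 x.2).
Local Notation h := (@product_edge L g).
Local Notation item := (VJ * (bool * nat))%type.
Implicit Types (x y z q : item) (s t u : seq item) (l : 'I_L).

Definition center_poly : {poly C} := 'X - lam%:P.
Hypothesis b_comm : forall x y : 'I_L * nat, copy_adj g x y -> bv x * bv y = bv y * bv x.
Hypothesis b_indep : forall w : seq (('I_L * nat) * {poly C}), w != [::] ->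
  reduced (copy_adj g) (vertices w) -> all (centered bv) w -> tau (word_val bv w) = 0.
Hypothesis b_mean : forall (l : 'I_L) (k : nat), centered bv ((l, k), center_poly).
Hypothesis b_var : forall (l : 'I_L) (k : nat),
  tau (letter_val bv ((l, k), center_poly * center_poly)) = s2.

Definition tags s : seq nat := [seq x.2.2 | x <- s].

(** An item is a subset J, a star flag and a tag. The star of a product of self-adjoint factors is
    the product in reverse order. *)
Definition item_support (x : VJ * (bool * nat)) : seq 'I_L :=
  if x.2.1 then rev (enum (val x.1)) else enum (val x.1).

Definition item_word (x : VJ * (bool * nat)) : seq (('I_L * nat) * {poly C}) :=
  [seq ((l, x.2.2), center_poly) | l <- item_support x].

Definition items_word s := flatten [seq item_word x | x <- s].

Definition items_val s := word_val bv (items_word s).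

Definition complete_set : pred VJ := fun J =>
  [forall i in val J, forall j in val J, (i != j) ==> g i j].

Lemma mem_tags x s : x \in s -> x.2.2 \in tags s.
Proof. by move=> xs; apply/mapP; exists x. Qed.

Lemma tags_cat s t : tags (s ++ t) = tags s ++ tags t.
Proof. exact: map_cat. Qed.

Lemma items_word_cat s t : items_word (s ++ t) = items_word s ++ items_word t.
Proof. by rewrite /items_word map_cat flatten_cat. Qed.

Lemma items_word_cons x t : items_word (x :: t) = item_word x ++ items_word t.
Proof. by []. Qed.

Lemma items_val_cat s t : items_val (s ++ t) = items_val s * items_val t.
Proof. by rewrite /items_val items_word_cat word_val_cat. Qed.

Lemma items_val_cons x t : items_val (x :: t) = word_val bv (item_word x) * items_val t.
Proof. by rewrite /items_val items_word_cons word_val_cat. Qed.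

Lemma mem_item_support x l : (l \in item_support x) = (l \in val x.1).
Proof. by rewrite /item_support; case: ifP => _; rewrite ?mem_rev mem_enum. Qed.

Lemma uniq_item_support x : uniq (item_support x).
Proof. by rewrite /item_support; case: ifP => _; rewrite ?rev_uniq enum_uniq. Qed.

Lemma vertices_item x : vertices (item_word x) = [seq (l, x.2.2) | l <- item_support x].
Proof. by rewrite /vertices /item_word -map_comp. Qed.

Lemma vertices_cat (w w' : seq (('I_L * nat) * {poly C})) :
  vertices (w ++ w') = vertices w ++ vertices w'.
Proof. exact: map_cat. Qed.

Lemma vertices_items s :
  vertices (items_word s) = flatten [seq vertices (item_word x) | x <- s].
Proof.
by elim: s => //= x s IH; rewrite items_word_cons vertices_cat; congr (_ ++ _).
Qed.

Lemma items_centered s : all (centered bv) (items_word s).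
Proof.
elim: s => //= x s; rewrite items_word_cons all_cat => ->; rewrite andbT.
by rewrite all_map; apply/allP => l _; apply: b_mean.
Qed.

Lemma filter_items0 (P : pred ('I_L * nat)) s :
  (forall x l, x \in s -> l \in val x.1 -> ~~ P (l, x.2.2)) ->
  [seq v <- vertices (items_word s) | P v] = [::].
Proof.
rewrite vertices_items; elim: s => //= x s IH Ps.
rewrite filter_cat IH => [|y l ys]; last by apply: Ps; rewrite inE ys orbT.
rewrite cats0 vertices_item; apply/eqP; rewrite -(negbK (_ == _)) -has_filter has_map.
by apply/hasPn => l /=; rewrite mem_item_support => lx; apply: Ps => //; apply: mem_head.
Qed.

Lemma filter_item1 (P : pred ('I_L * nat)) x l : l \in val x.1 ->
  (forall l', P (l', x.2.2) = (l' == l)) ->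
  [seq v <- vertices (item_word x) | P v] = [:: (l, x.2.2)].
Proof.
move=> lx Pl; rewrite vertices_item filter_map (eq_filter (a2 := pred1 l)) //.
by rewrite filter_pred1_uniq ?uniq_item_support ?mem_item_support.
Qed.

Lemma tau_items_reduced (P : pred ('I_L * nat)) s p :
  [seq v <- vertices (items_word s) | P v] = p -> p != [::] -> reduced (copy_adj g) p ->
  tau (items_val s) = 0.
Proof.
move=> Pp p0 rp; apply: (tau_reduced_sub b_comm b_indep (P := P)).
- by apply/allP => x /(allP (items_centered s)) ->; rewrite implybT.
- by rewrite Pp.
- by rewrite has_filter Pp.
Qed.

(** The vertex [(l, x.2.2)] occurs once in the word, and a single centered letter is reduced. *)
Lemma tau_items_single s t x l : l \in val x.1 ->
  (forall y, y \in s ++ t -> y.2.2 = x.2.2 -> l \notin val y.1) ->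
  tau (items_val (s ++ x :: t)) = 0.
Proof.
move=> lx ly; have st0 u : {subset u <= s ++ t} ->
    [seq v <- vertices (items_word u) | pred1 (l, x.2.2) v] = [::].
  move=> ust; apply: filter_items0 => y l' yu /= l'y; apply/eqP => -[el e].
  by move: (ly y (ust _ yu) e); rewrite -el l'y.
apply: (@tau_items_reduced (pred1 (l, x.2.2)) _ [:: (l, x.2.2)]) => //.
rewrite items_word_cat items_word_cons !vertices_cat !filter_cat.
rewrite (st0 s) => [|y ys]; last by rewrite mem_cat ys.
rewrite (st0 t) => [|y ys]; last by rewrite mem_cat ys orbT.
by rewrite (filter_item1 lx) // => l'; rewrite /= xpair_eqE eqxx andbT.
Qed.

(** At the two vertices given by [l] with the tag of [x] and [l'] with the tag of [q], the word
    reads l, l', l, preceded by at most one l'. These vertices are distinct and not adjacent, so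
    this alternating subword is reduced. *)
Lemma tau_items_cross s0 x s1 q s3 y s4 l l' :
  l \in val x.1 -> l' \in val q.1 -> y.1 = x.1 -> y.2.2 = x.2.2 -> ~~ g l l' ->
  x.2.2 \notin tags (s0 ++ s1 ++ q :: s3 ++ s4) ->
  q.2.2 \notin tags (s1 ++ s3 ++ s4) ->
  (count_mem q.2.2 (tags s0) <= 1)%N ->
  tau (items_val (s0 ++ x :: s1 ++ q :: s3 ++ y :: s4)) = 0.
Proof.
move=> lx lq eyx eyk ngl nk nq cq.
have nkq : x.2.2 != q.2.2.
  by apply: contraNneq nk => ->; apply: mem_tags; rewrite !mem_cat mem_head !orbT.
pose P := pred2 (l, x.2.2) (l', q.2.2).
have st0 u : x.2.2 \notin tags u -> q.2.2 \notin tags u ->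
    [seq v <- vertices (items_word u) | P v] = [::].
  move=> xu qu; apply: filter_items0 => z l2 zu _; rewrite /P /= !xpair_eqE.
  apply/negP => /orP[] /andP[_ /eqP e].
    by move: xu; rewrite -e mem_tags.
  by move: qu; rewrite -e mem_tags.
have Px z : z.2.2 = x.2.2 -> l \in val z.1 ->
    [seq v <- vertices (item_word z) | P v] = [:: (l, x.2.2)].
  move=> e lz; rewrite -e; apply: filter_item1 => // l2.
  by rewrite /P /= !xpair_eqE e eqxx (negPf nkq) !andbF andbT orbF.
have Pq z : z.2.2 = q.2.2 -> [seq v <- vertices (item_word z) | P v] = [:: (l', q.2.2)]
    \/ [seq v <- vertices (item_word z) | P v] = [::].
  move=> e; have [lz|nlz] := boolP (l' \in val z.1).
    left; rewrite -e; apply: filter_item1 => // l2.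
    by rewrite /P /= !xpair_eqE e eqxx (eq_sym q.2.2) (negPf nkq) !andbF andbT.
  right; rewrite -(cats0 (item_word z)) -[_ ++ _]/(items_word [:: z]).
  apply: filter_items0 => z' l2; rewrite inE => /eqP-> l2z.
  rewrite /P /= !xpair_eqE e eqxx (eq_sym q.2.2) (negPf nkq) !andbF andbT /=.
  by apply: contraNneq nlz => <-.
have Pqq : [seq v <- vertices (item_word q) | P v] = [:: (l', q.2.2)].
  apply: filter_item1 => // l2.
  by rewrite /P /= !xpair_eqE eqxx (eq_sym q.2.2) (negPf nkq) !andbF andbT.
have nxs u : {subset u <= s0 ++ s1 ++ q :: s3 ++ s4} -> x.2.2 \notin tags u.
  move=> us; apply: contra nk => /mapP[z zu ->]; apply: mem_tags; exact: us.
have nqs u : {subset u <= s1 ++ s3 ++ s4} -> q.2.2 \notin tags u.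
  move=> us; apply: contra nq => /mapP[z zu ->]; apply: mem_tags; exact: us.
have P0 : [seq v <- vertices (items_word s0) | P v] = [:: (l', q.2.2)]
    \/ [seq v <- vertices (items_word s0) | P v] = [::].
  have [/mapP[z zs0 eqz]|nqs0] := boolP (q.2.2 \in tags s0); last first.
    by right; apply: st0 => //; apply: nxs => z zs; rewrite mem_cat zs.
  case/splitPr: zs0 cq nxs => u t cq nxs.
  have : (count_mem q.2.2 (tags u) + count_mem q.2.2 (tags t) == 0)%N.
    rewrite -leqn0 -ltnS; apply: leq_trans cq.
    by rewrite tags_cat count_cat /= -eqz eqxx addnCA.
  rewrite addn_eq0 => /andP[/eqP/count_memPn zu /eqP/count_memPn zt].
  rewrite items_word_cat items_word_cons !vertices_cat !filter_cat.
  rewrite (st0 u) //; last by apply: nxs => y' ys; rewrite !mem_cat ys.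
  rewrite (st0 t) //; last by apply: nxs => y' ys; rewrite !mem_cat inE ys !orbT.
  by rewrite cats0 /=; apply: Pq.
have nll : (l, x.2.2) != (l', q.2.2) by rewrite xpair_eqE (negPf nkq) andbF.
have e : [seq v <- vertices (items_word (s0 ++ x :: s1 ++ q :: s3 ++ y :: s4)) | P v]
    = [seq v <- vertices (items_word s0) | P v] ++ [:: (l, x.2.2); (l', q.2.2); (l, x.2.2)].
  rewrite !(items_word_cat, items_word_cons) !vertices_cat !filter_cat.
  rewrite (st0 s1) ?nxs ?nqs //; last 2 first.
  - by move=> z zs; rewrite !(mem_cat, inE) zs ?orbT.
  - by move=> z zs; rewrite !(mem_cat, inE) zs ?orbT.
  rewrite (st0 s3) ?nxs ?nqs //; last 2 first.
  - by move=> z zs; rewrite !(mem_cat, inE) zs ?orbT.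
  - by move=> z zs; rewrite !(mem_cat, inE) zs ?orbT.
  rewrite (st0 s4) ?nxs ?nqs //; last 2 first.
  - by move=> z zs; rewrite !(mem_cat, inE) zs ?orbT.
  - by move=> z zs; rewrite !(mem_cat, inE) zs ?orbT.
  by rewrite (Px x) // Pqq (Px y) // eyx.
apply: (tau_items_reduced e); first by case: P0 => ->.
have gl : copy_adj g (l, x.2.2) (l', q.2.2) = false by apply/negbTE.
have gl' : copy_adj g (l', q.2.2) (l, x.2.2) = false by rewrite /copy_adj edge_sym; apply/negbTE.
by case: P0 => -> /=; rewrite !(eq_sym (l', q.2.2)) !(negPf nll) gl gl' ?eqxx.
Qed.

Lemma item_word_comm x y : h x.1 y.1 ->
  GRing.comm (word_val bv (item_word x)) (word_val bv (item_word y)).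
Proof.
move=> /'forall_implyP hxy.
have key l : l \in val x.1 ->
      all (fun w : ('I_L * nat) * {poly C} => copy_adj g (l, x.2.2) w.1) (item_word y).
  move=> lx; rewrite all_map; apply/allP => l' /=; rewrite mem_item_support.
  by have /'forall_implyP := hxy l lx; apply.
have: all (fun l => l \in val x.1) (item_support x).
  by apply/allP => l; rewrite mem_item_support.
rewrite /item_word -/(item_word y); elim: item_support => [|l s IH] /=.
  by rewrite word_val_nil => _; apply: commr_sym; apply: commr1.
case/andP=> lx /IH cs; rewrite word_val_cons; apply: commr_sym; apply: commrM.
  apply: commr_sym; rewrite /GRing.comm.
  by rewrite (word_val_comm b_comm (x := ((l, x.2.2), center_poly)) (key l lx)).
exact: commr_sym.
Qed.

Lemma items_val_comm x s : all (fun y => h x.1 y.1) s ->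
  word_val bv (item_word x) * items_val s = items_val s * word_val bv (item_word x).
Proof.
elim: s => [|y s IH] /=; first by rewrite /items_val /items_word word_val_nil mulr1 mul1r.
case/andP=> /item_word_comm cxy /IH e; rewrite items_val_cons mulrA cxy -mulrA e mulrA.
by [].
Qed.

Definition copy_word k (s : seq 'I_L) : seq (('I_L * nat) * {poly C}) :=
  [seq ((l, k), center_poly) | l <- s].

Lemma tau_letter_sq l k :
  tau (word_val bv ([:: ((l, k), center_poly)] ++ [:: ((l, k), center_poly)])) = s2.
Proof.
rewrite -[_ ++ _]/([::] ++ ((l, k), center_poly) :: [::] ++ ((l, k), center_poly) :: [::]).
by rewrite (word_val_merge b_comm) //= word_val_cons word_val_nil mulr1 b_var.
Qed.

(** The inner palindrome is contiguous and shares no vertex with the outer pair, so [tau_factor]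
    separates them. *)
Lemma tau_palindrome k (s : seq 'I_L) : uniq s ->
  tau (word_val bv (copy_word k s ++ rev (copy_word k s))) = s2 ^+ size s.
Proof.
elim: s => [|l s IH] /=; first by rewrite word_val_nil tau1.
case/andP=> ls us; rewrite rev_cons -cat_cons -rcons_cat -cats1 /=.
rewrite -[_ :: _ ++ [:: _]]/([:: ((l, k), center_poly)] ++ (copy_word k s ++
  rev (copy_word k s)) ++ [:: ((l, k), center_poly)]).
rewrite (tau_factor b_comm b_indep (P := fun v => v.1 \in s)) /=; last 3 first.
- rewrite /vertices map_cat map_rev all_cat all_rev andbb -map_comp all_map.
  by apply/allP.
- by rewrite orbF.
- by rewrite orbF.
by rewrite IH // tau_letter_sq exprSr.
Qed.

(** In a clique the second [l] commutes back to the first one and merges with it into a variance. *)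
Lemma tau_square k (s : seq 'I_L) : uniq s -> {in s &, forall i j, i != j -> g i j} ->
  tau (word_val bv (copy_word k s ++ copy_word k s)) = s2 ^+ size s.
Proof.
elim: s => [|l s IH] /=; first by rewrite word_val_nil tau1.
case/andP=> ls us gs.
rewrite -[_ :: _ ++ _]/([::] ++ ((l, k), center_poly) :: copy_word k s ++
  ((l, k), center_poly) :: copy_word k s).
rewrite (word_val_merge b_comm); last first.
  rewrite all_map; apply/allP => i si.
  have nli : l != i by apply: contraNneq ls => ->.
  by apply: (gs l i) => //; rewrite inE ?eqxx ?si ?orbT.
rewrite /= -[_ :: _ ++ _]/([:: ((l, k), center_poly * center_poly)] ++ _).
rewrite -[X in _ ++ X]cats0.
rewrite (tau_factor b_comm b_indep (P := fun v => v.1 \in s)) /=; last 3 first.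
- by rewrite /vertices map_cat all_cat andbb -map_comp all_map; apply/allP.
- by rewrite orbF.
- by [].
rewrite IH // => [|i j si sj]; last by apply: gs; rewrite inE ?si ?sj orbT.
by rewrite word_val_cons word_val_nil mulr1 b_var exprSr.
Qed.

Lemma filter_pred2_uniq (T : eqType) (i j : T) (s : seq T) :
  uniq s -> i \in s -> j \in s -> i != j ->
  [seq x <- s | pred2 i j x] = [:: i; j] \/ [seq x <- s | pred2 i j x] = [:: j; i].
Proof.
move=> us si sj nij.
have p : perm_eq [seq x <- s | pred2 i j x] [:: i; j].
  apply: uniq_perm; rewrite ?filter_uniq //= ?inE ?nij // => x.
  by rewrite mem_filter !inE /=; case: (x =P i) => [->|_] //=; case: (x =P j) => [->|].
have := perm_size p; have := perm_uniq p; have := perm_mem p.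
case: [seq x <- s | pred2 i j x] => [|x [|y []]] //= m + _.
have /pred2P mx : pred2 i j x by have := m x; rewrite !inE eqxx /= => <-.
have /pred2P my : pred2 i j y by have := m y; rewrite !inE eqxx orbT /= => <-.
rewrite !inE nij andbT /=.
by case: mx my => -> [] ->; rewrite ?eqxx //; [left|right].
Qed.

(** This is the covariance of a semicircular or circular variable, up to scale. If J is not a
    clique, non-adjacent i and j in J give X^J X^J the reduced centered subword i j i j or j i j
    i. *)
Lemma tau_pair J e e' k : tau (items_val [:: (J, (e, k)); (J, (e', k))]) =
  if matches complete_set J e e' then s2 ^+ #|val J| else 0.
Proof.
have eV : items_val [:: (J, (e, k)); (J, (e', k))] =
    word_val bv (item_word (J, (e, k)) ++ item_word (J, (e', k))).
  by rewrite /items_val /items_word /= cats0.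
have sz e0 : #|val J| = size (item_support (J, (e0, k))).
  by rewrite /item_support; case: ifP => _; rewrite ?size_rev -cardE.
rewrite /matches; case: (boolP (complete_set J)) => /= [cJ|ncJ].
  case: (e =P e') => [ee'|ne].
    rewrite eV ee' -[item_word _]/(copy_word k (item_support _)) (sz e').
    apply: tau_square; first exact: uniq_item_support.
    move=> i j; rewrite !mem_item_support /= => iJ jJ nij.
    move: cJ => /'forall_implyP/(_ i iJ)/'forall_implyP/(_ j jJ).
    by rewrite nij.
  rewrite eV (sz e) -(@tau_palindrome k) ?uniq_item_support //.
  rewrite /item_word -map_rev /item_support /=.
  by case: e e' ne {eV sz} => [] [] //= _; rewrite ?revK.
case: (e =P e') => [ee'|ne] /=; last first.
  rewrite eV (sz e) -(@tau_palindrome k) ?uniq_item_support //.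
  rewrite /item_word -map_rev /item_support /=.
  by case: e e' ne {eV sz} => [] [] //= _; rewrite ?revK.
have [i [j [iJ jJ nij ngij]]] : exists i j, [/\ i \in val J, j \in val J, i != j & ~~ g i j].
  move: ncJ; rewrite negb_forall_in => /exists_inP[i iJ].
  rewrite negb_forall_in => /exists_inP[j jJ].
  by rewrite negb_imply => /andP[nij ngij]; exists i, j.
have [p [ep rp p0]] : exists p, [/\ [seq v <- vertices (item_word (J, (e', k))) |
    pred2 (i, k) (j, k) v] = p, reduced (copy_adj g) (p ++ p) & p != [::]].
  rewrite vertices_item filter_map (eq_filter (a2 := pred2 i j)); last first.
    by move=> l /=; rewrite !xpair_eqE eqxx !andbT.
  have ngji : ~~ g j i by rewrite edge_sym.
  have nk : ((j, k) == (i, k)) = false by rewrite xpair_eqE eq_sym (negPf nij).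
  have nk' : ((i, k) == (j, k)) = false by rewrite xpair_eqE (negPf nij).
  have adj1 : copy_adj g (i, k) (j, k) = false by apply/negbTE.
  have adj2 : copy_adj g (j, k) (i, k) = false by apply/negbTE.
  by case: (@filter_pred2_uniq _ i j (item_support (J, (e', k))));
    rewrite ?uniq_item_support ?mem_item_support // => ->; eexists; split => //=;
    rewrite ?nk ?nk' ?adj1 ?adj2.
rewrite ee'; apply: (@tau_items_reduced (pred2 (i, k) (j, k)) _ (p ++ p)) => //;
  last by case: (p) p0.
by rewrite -[items_word _]cats0 /items_word /= !cats0 !vertices_cat !filter_cat ep.
Qed.

Lemma items_val_push W v e k bs ab r be :
  normal h bs -> locate h v bs = (ab, r, be) ->
  items_val (W ++ (v, (e, k)) :: flat bs) =
  items_val (W ++ flat (ab ++ (v, (e, k) :: r) :: be)).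
Proof.
move=> nb loc; have [-> hab _ _] := locateP nb loc.
rewrite !flat_cat flat_add_block flat_cons /= !items_val_cat !items_val_cons !items_val_cat.
congr (_ * _); rewrite !mulrA; congr (_ * _ * _).
by apply: items_val_comm; apply: all_flat.
Qed.

(** The tag [k] is carried by two different subsets; an [l] in only one of them gives a vertex
    [(l, k)] that occurs once. *)
Lemma tau_items_mismatch W v e k bs y :
  uniq (tags (flat bs)) -> k \notin tags W -> y \in flat bs -> y.2.2 = k -> y.1 != v ->
  tau (items_val (W ++ (v, (e, k)) :: flat bs)) = 0.
Proof.
move=> ub nW yb; case/splitPr: yb ub => f1 f2 ub eyk nyv.
have nk (f : seq item) : {subset f <= f1 ++ f2} -> forall z, z \in f -> z.2.2 != k.
  move=> sf z zf; apply/eqP => ezk; move: ub.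
  rewrite tags_cat -[tags (y :: f2)]/([:: y.2.2] ++ tags f2) uniq_catCA /= -tags_cat eyk -ezk.
  by rewrite mem_tags ?sf.
have nkW z : z \in W -> z.2.2 != k.
  by move=> zW; apply: contraNneq nW => <-; rewrite mem_tags.
have : val y.1 != val v by rewrite (inj_eq val_inj).
rewrite finset.eqEsubset negb_and => /orP[] /subsetPn[l l1 l2].
  rewrite -cat_cons catA; apply: (tau_items_single l1) => z.
  rewrite !mem_cat inE eyk => /orP[/orP[zW|/predU1P[->//|zf]]|zf] /eqP.
  - by rewrite (negPf (nkW _ zW)).
  - by rewrite (negPf (nk f1 _ _ zf)) // => x xf; rewrite mem_cat xf.
  - by rewrite (negPf (nk f2 _ _ zf)) // => x xf; rewrite mem_cat xf orbT.
apply: (tau_items_single (x := (v, (e, k))) l1) => z.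
rewrite !mem_cat inE => /or4P[zW|zf|/eqP->//|zf] /eqP.
- by rewrite (negPf (nkW _ zW)).
- by rewrite (negPf (nk f1 _ _ zf)) // => x xf; rewrite mem_cat xf.
- by rewrite (negPf (nk f2 _ _ zf)) // => x xf; rewrite mem_cat xf orbT.
Qed.

Definition tag_count (k : nat) (s : seq item) : nat := count_mem k (tags s).

Lemma tag_count_cat k s t : tag_count k (s ++ t) = (tag_count k s + tag_count k t)%N.
Proof. by rewrite /tag_count tags_cat count_cat. Qed.

Lemma tag_count_cons k x s : tag_count k (x :: s) = ((x.2.2 == k) + tag_count k s)%N.
Proof. by []. Qed.

Lemma tag_count0 k s : (k \notin tags s) <-> tag_count k s = 0%N.
Proof. by split=> [/count_memPn|/count_memPn]. Qed.

(** The new letter repeats a tag of the state. If its partner is the top of the reachable block, the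
    pair becomes contiguous and factors out. Otherwise the partner carries another subset, or lies
    behind a non-neighbour of [v], with which the pair crosses; the moment is then 0. *)
Lemma tau_items_close W v e k bs ab r be :
  normal h bs -> locate h v bs = (ab, r, be) -> uniq (tags (flat bs)) ->
  k \in tags (flat bs) -> k \notin tags W ->
  {in tags (flat bs), forall j, (count_mem j (tags W) <= 1)%N} ->
  tau (items_val (W ++ (v, (e, k)) :: flat bs)) =
  if r is x :: r' then
    if (x.2 == k) && matches complete_set v e x.1 then
      s2 ^+ #|val v| * tau (items_val (W ++ flat (ab ++ add_block v r' be)))
    else 0
  else 0.
Proof.
move=> nb loc ub kb nW cW; have [eb hab ur r0] := locateP nb loc.
case: (boolP (if r is x :: _ then x.2 == k else false)) => [|nrk].
  case: r r0 loc eb => // -[e' k'] r _ loc eb /= /eqP ek; rewrite ek eqxx /=.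
  rewrite ek in loc eb.
  rewrite (items_val_push _ _ _ nb loc) !flat_cat flat_cons flat_add_block /=.
  move: ub; rewrite eb flat_cat flat_cons /= tags_cat.
  rewrite -[tags (_ :: _)]/([:: k] ++ tags _) uniq_catCA /= => /andP[nk _].
  have -> : items_val (W ++ flat ab ++ (v, (e, k)) :: (v, (e', k)) ::
      [seq (v, p) | p <- r] ++ flat be) =
      word_val bv (items_word (W ++ flat ab) ++ items_word [:: (v, (e, k)); (v, (e', k))] ++
        items_word ([seq (v, p) | p <- r] ++ flat be)).
    by rewrite -!items_word_cat /items_val -catA.
  have nP s : k \notin tags s -> ~~ has (fun c : 'I_L * nat => c.2 == k) (vertices (items_word s)).
    move=> ns; apply/hasPn => c; rewrite vertices_items => /flattenP[_ /mapP[x xs ->]].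
    rewrite vertices_item => /mapP[l _ ->] /=; apply: contraNneq ns => <-; exact: mem_tags.
  have nk' : k \notin tags ([seq (v, p) | p <- r] ++ flat be).
    by move: nk; rewrite -tags_cat; apply: contra; rewrite tags_cat mem_cat => ->; rewrite orbT.
  have nk'' : k \notin tags (W ++ flat ab).
    rewrite tags_cat mem_cat negb_or nW; apply: contra nk => ka.
    by rewrite mem_cat ka.
  rewrite (tau_factor b_comm b_indep (P := fun c => c.2 == k)) ?nP //; last first.
    rewrite vertices_items /= cats0 all_cat !vertices_item !all_map /=.
    by apply/andP; split; apply/allP => l _ /=.
  rewrite -[word_val bv (items_word _)]/(items_val _) tau_pair.
  rewrite -items_word_cat -catA -[word_val bv _]/(items_val _).
  by case: matches; rewrite ?mul0r.
transitivity (0 : C); last first.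
  by case: r nrk {loc eb r0} => // x r' /negPf ->.
have /mapP[y yb eyk] := kb.
have [eyv|nyv] := eqVneq y.1 v; last by apply: (@tau_items_mismatch W v e k bs y).
rewrite (items_val_push _ _ _ nb loc) flat_cat flat_cons /=.
have ebf : flat bs = flat ab ++ ([seq (v, p) | p <- r] ++ flat be).
  by rewrite eb flat_cat flat_add_block.
have yZ : y \in [seq (v, p) | p <- r] ++ flat be.
  move: yb; rewrite ebf mem_cat => /orP[ya|//].
  have /allP/(_ _ ya) := all_flat hab; rewrite eyv /= => hvv.
  by rewrite (product_edge_irr g v) in hvv.
have [m [m' eZ]] : exists m m', [seq (v, p) | p <- r] ++ flat be = m ++ y :: m'.
  by case/splitPr: yZ => m m'; exists m, m'.
(* The blocking letter [q] is the top of the block of [v] itself, as [h] has no loops, or a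
   non-neighbour of [v] if no block is reachable. *)
have /hasP[q qm nvq] : has (fun q => ~~ h v q.1) m.
  case: r nrk r0 loc eb eZ {yZ ebf} => [_ /(_ erefl) eab loc eb|x r nxk _ _ _] /= eZ.
    have nbe : normal h be by rewrite eb eab in nb.
    rewrite has_predC; apply/negP => am.
    have := unreachable_flat nbe ur; rewrite eZ map_cat /= eyv reachable_cat //.
    by rewrite all_map.
  case: m eZ => [|z m] /= [ez _].
    by move: nxk; rewrite eyk -ez /= eqxx.
  by rewrite -ez /= (product_edge_irr g v).
have [m1 [m2 em]] : exists m1 m2, m = m1 ++ q :: m2.
  by case/splitPr: qm => m1 m2; exists m1, m2.
have [l [l' [lv lq ngl]]] : exists l l', [/\ l \in val v, l' \in val q.1 & ~~ g l l'].
  move: nvq; rewrite negb_forall_in => /exists_inP[l lv].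
  by rewrite negb_forall_in => /exists_inP[l' lq ngl]; exists l, l'.
have ebt : flat bs = flat ab ++ m1 ++ q :: m2 ++ y :: m' by rewrite ebf eZ em -catA.
rewrite eZ em -catA cat_cons catA.
have qbs : q \in flat bs by rewrite ebt !mem_cat mem_head !orbT.
have nq : tag_count q.2.2 (flat bs) = 1%N.
  by rewrite /tag_count count_uniq_mem // mem_tags.
have ny : tag_count k (flat bs) = 1%N by rewrite /tag_count count_uniq_mem // kb.
have nW0 : tag_count k W = 0%N by apply/tag_count0.
rewrite ebt !(tag_count_cat, tag_count_cons) -eyk eqxx in ny.
rewrite ebt !(tag_count_cat, tag_count_cons) eqxx -eyk in nq.
have nqk : (q.2.2 == k) = false by apply/negP => /eqP eq; move: nq; rewrite eq eqxx; clear; lia.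
rewrite nqk in ny; rewrite (eq_sym k) nqk in nq.
apply: (@tau_items_cross _ (v, (e, k)) _ q _ y _ l l') => //=.
- apply/tag_count0; rewrite !(tag_count_cat, tag_count_cons) nqk; move: nW0 ny.
  case: (tag_count k W) (tag_count k (flat ab)) (tag_count k m1) (tag_count k m2)
    (tag_count k m') => // a0 a1 a2 a3; clear; lia.
- apply/tag_count0; rewrite !(tag_count_cat, tag_count_cons); move: nq.
  move: (tag_count _ (flat ab)) (tag_count _ m1) (tag_count _ m2) (tag_count _ m').
  by move=> a0 a1 a2 a3; clear; lia.
- rewrite -[count_mem _ _]/(tag_count _ _) tag_count_cat.
  have : (tag_count q.2.2 W <= 1)%N := cW q.2.2 (mem_tags qbs).
  move: nq; move: (tag_count _ (flat ab)) (tag_count _ m1) (tag_count _ m2) (tag_count _ m').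
  by move: (tag_count _ W) => a0 a1 a2 a3 a4; clear; lia.
Qed.

(** * Sums over pairings of tags *)

Section PairedSums.
Variable sg : C.
Hypothesis s2E : s2 = sg ^+ 2.
Implicit Types (bs : seq (VJ * seq (bool * nat))) (w : seq (VJ * bool)) (U ks : seq nat).

Definition tag_word w ks : seq item := [seq (c.1.1, (c.1.2, c.2)) | c <- zip w ks].

Lemma tags_tagged w ks : size ks = size w -> tags (tag_word w ks) = ks.
Proof.
move=> e; rewrite /tags /tag_word -map_comp.
by rewrite (eq_map (g := snd)) // -[map _ _]/(unzip2 _) unzip2_zip // e.
Qed.

(** The value [s2 ^+ #|val J|] of a pair is shared equally between its two letters, which matches
    the coefficient of [s J] in the limit. *)
Definition set_weight (J : VJ) : C := sg ^+ #|val J|.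
Definition weight bs : C := \prod_(x <- flat bs) set_weight x.1.
Definition word_weight w : C := \prod_(c <- w) set_weight c.1.

Lemma weight_cat bs1 bs2 : weight (bs1 ++ bs2) = weight bs1 * weight bs2.
Proof. by rewrite /weight flat_cat big_cat. Qed.

Lemma weight_push ab v e r be bs : bs = ab ++ add_block v r be ->
  weight (ab ++ (v, e :: r) :: be) = set_weight v * weight bs.
Proof.
move=> ->; rewrite !weight_cat mulrCA; congr (_ * _).
by rewrite /weight flat_add_block flat_cons /= big_cons.
Qed.

Lemma weight_pop ab v e r be bs : bs = ab ++ add_block v (e :: r) be ->
  weight bs = set_weight v * weight (ab ++ add_block v r be).
Proof. by move=> ->; rewrite -(weight_push e erefl). Qed.

(** The state holds the letters whose tag has been met once, [U] the tags met twice. The unread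
    letters stand reversed to the left of the state, so the head of [w] acts next. *)
Definition paired_sum n bs U w : C :=
  \sum_(ks <- tag_seqs n (size w) | pairing (tags (flat bs) ++ U ++ U ++ ks))
    tau (items_val (rev (tag_word w ks) ++ flat bs)).

Definition first_tag_sum n bs U w (x : VJ * bool) k : C :=
  \sum_(ks <- tag_seqs n (size w) | pairing (tags (flat bs) ++ U ++ U ++ k :: ks))
    tau (items_val (rev (tag_word w ks) ++ (x.1, (x.2, k)) :: flat bs)).

Lemma paired_sum_cons n bs U (x : VJ * bool) w :
  paired_sum n bs U (x :: w) = \sum_(k <- iota 0 n) first_tag_sum n bs U w x k.
Proof.
rewrite /paired_sum big_mkcond big_allpairs_dep; apply: eq_bigr => k _.
rewrite /first_tag_sum [RHS]big_mkcond; apply: eq_bigr => ks _.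
by rewrite /tag_word /= rev_cons cat_rcons.
Qed.

Lemma first_tag_sum_closed n bs U w (x : VJ * bool) k : k \in U -> first_tag_sum n bs U w x k = 0.
Proof.
by move=> kU; rewrite /first_tag_sum big_pred0 // => ks; apply: pairing_closed_tag.
Qed.

Lemma tags_push ab v e k r be bs : bs = ab ++ add_block v r be ->
  perm_eq (tags (flat (ab ++ (v, (e, k) :: r) :: be))) (k :: tags (flat bs)).
Proof.
move=> ->; rewrite !flat_cat flat_cons flat_add_block /= !(tags_cat (flat ab)).
by rewrite -[tags (_ :: _)]/([:: k] ++ tags _) perm_catCA.
Qed.

Lemma first_tag_sum_new n bs U w v e k ab r be :
  normal h bs -> locate h v bs = (ab, r, be) -> 
  first_tag_sum n bs U w (v, e) k = paired_sum n (ab ++ (v, (e, k) :: r) :: be) U w.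
Proof.
move=> nb loc; have [eb _ _ _] := locateP nb loc.
rewrite /first_tag_sum /paired_sum; apply: eq_big => [ks|ks _]; last first.
  by rewrite (items_val_push _ _ _ nb loc).
apply: perm_pairing; apply: perm_push_tag; exact: tags_push.
Qed.

Lemma first_tag_sum_old n bs U w v e k ab r be :
  normal h bs -> locate h v bs = (ab, r, be) -> uniq (tags (flat bs)) ->
  k \in tags (flat bs) ->
  first_tag_sum n bs U w (v, e) k =
  if r is c :: r' then
    if (c.2 == k) && matches complete_set v e c.1 then
      s2 ^+ #|val v| * paired_sum n (ab ++ add_block v r' be) (k :: U) w
    else 0
  else 0.
Proof.
move=> nb loc ub kb; have [eb _ _ _] := locateP nb loc.
pose c t := if r is c :: r' then
    if (c.2 == k) && matches complete_set v e c.1 then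
      s2 ^+ #|val v| * tau (items_val (t ++ flat (ab ++ add_block v r' be)))
    else 0 else 0 : C.
transitivity (\sum_(ks <- tag_seqs n (size w) | pairing (tags (flat bs) ++ U ++ U ++ k :: ks))
    c (rev (tag_word w ks))).
  rewrite /first_tag_sum big_seq_cond [RHS]big_seq_cond.
  apply: eq_bigr => ks /andP[/size_mem_tag_seqs sk pk].
  have cj j : count_mem j (tags (rev (tag_word w ks))) = count_mem j ks.
    by rewrite /tags map_rev count_rev -[map _ _]/(tags _) tags_tagged.
  rewrite /c /=; apply: (tau_items_close _ nb loc ub kb) => [|j jb].
    apply/count_memPn; rewrite cj.
    by have := pairing_open_tag ub kb pk; rewrite /= eqxx add1n ltnS leqn0 => /eqP.
  rewrite cj; apply: leq_trans (pairing_open_tag ub jb pk); exact: leq_addl.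
rewrite {}/c; case: r loc eb => [|x r] loc eb; first by rewrite big1.
case: ifP => [/andP[/eqP xk _]|_]; last by rewrite big1.
rewrite /paired_sum mulr_sumr; apply: eq_bigl => ks; apply: perm_pairing.
apply: perm_pop_tag; rewrite eb -xk.
by have := tags_push x.1 x.2 (erefl (ab ++ add_block v r be)); case: (x).
Qed.

(* A pairing of the tags is read one letter at a time: a fresh tag pushes its letter, a
   repeated tag contributes only if its partner is the top of the reachable block. *)
Lemma paired_sum_fock n bs U w : normal h bs ->
  uniq (tags (flat bs) ++ U) -> all (fun k => k < n)%N (tags (flat bs) ++ U) ->
  paired_sum n bs U w = weight bs * word_weight w *
    fock h complete_set (fun j => (n - j)%:R) (size (tags (flat bs)) + size U)%N
      (map_blocks fst bs) w.
Proof.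
elim: w bs U => [|[v e] w IH] bs U nb; rewrite cat_uniq => /and3P[uT UT uU] lt_n.
  rewrite /paired_sum /= big_cons big_nil addr0 cats0.
  have e0 : (map_blocks fst bs == [::]) = (flat bs == [::]).
    by rewrite (flat_eq0 nb) /map_blocks -size_eq0 size_map size_eq0.
  rewrite e0 /word_weight big_nil mulr1 /weight.
  case eb : (flat bs) => [|x f] /=.
    rewrite big_nil mul1r /items_val /items_word /= word_val_nil tau1.
    case: ifP => // /negP[]; apply/allP => k kU.
    rewrite count_cat (count_uniq_mem _ uU); move: kU; rewrite mem_cat orbb => -> //.
  rewrite mulr0; case: ifP => // /andP[+ _].
  move: uT UT; rewrite eb /= => /andP[xf _] /hasPn xU.
  have {}xU : count_mem x.2.2 U = 0%N.
    by apply/count_memPn/negP => /xU; rewrite /= inE eqxx.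
  by rewrite eqxx !count_cat xU /= (count_memPn xf).
case loc: (locate h v bs) => [[ab r] be]; have [eb _ _ _] := locateP nb loc.
set T := tags (flat bs) in uT UT lt_n *.
rewrite paired_sum_cons /= locate_map loc.
pose cP := set_weight v * weight bs * word_weight w *
  fock h complete_set (fun j => (n - j)%:R) (size T + size U).+1%N
    (map_blocks fst ab ++ (v, e :: map fst r) :: map_blocks fst be) w.
pose cQ (r' : seq (bool * nat)) := s2 ^+ #|val v| * (weight (ab ++ add_block v r' be) *
  word_weight w * fock h complete_set (fun j => (n - j)%:R) (size T + size U)%N
    (map_blocks fst (ab ++ add_block v r' be)) w).
have Tmem c r' : r = c :: r' -> c.2 \in T.
  move=> er; rewrite /T eb er /= flat_cat flat_cons tags_cat mem_cat.
  by rewrite /tags /= mem_head orbT.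
have G k : k \in iota 0 n -> first_tag_sum n bs U w (v, e) k =
    (if k \notin T ++ U then cP else 0) +
    (if r is c :: r' then
       if (c.2 == k) && matches complete_set v e c.1 then cQ r' else 0 else 0).
  rewrite mem_iota add0n => /= kn; rewrite mem_cat.
  case: (boolP (k \in T)) => [kT|nkT] /=.
    rewrite add0r (first_tag_sum_old _ _ _ _ nb loc uT kT).
    case: r loc eb Tmem @cP => // x r loc eb _ _; case: ifP => // /andP[/eqP xk _].
    have eT : perm_eq T (k :: tags (flat (ab ++ add_block v r be))).
      have := tags_push x.1 x.2 (erefl (ab ++ add_block v r be)).
      by rewrite /T eb -xk; case: (x).
    have eTU : perm_eq (T ++ U) (tags (flat (ab ++ add_block v r be)) ++ k :: U).
      exact: perm_pop_used.
    rewrite /cQ IH.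
    - congr (_ * (_ * _)); congr (fock _ _ _ _ _ _).
      by have := perm_size eTU; rewrite !size_cat.
    - by apply: (normal_pop _ _ nb loc); [exact: product_edge_sym|exact: product_edge_irr].
    - by rewrite -(perm_uniq eTU) cat_uniq uT UT.
    - by rewrite -(perm_all _ eTU).
  have e0 : (if r is c :: r' then
       if (c.2 == k) && matches complete_set v e c.1 then cQ r' else 0 else 0) = 0.
    case: r Tmem {loc eb cP} => // x r /(_ x r erefl) xT.
    by case: eqP => //= xk; rewrite -xk xT in nkT.
  rewrite e0 addr0; case: (boolP (k \in U)) => [kU|nkU] /=.
    exact: first_tag_sum_closed.
  rewrite (first_tag_sum_new _ _ _ _ _ nb loc).
  have pT := tags_push e k eb.
  have eTU : perm_eq (k :: T ++ U) (tags (flat (ab ++ (v, (e, k) :: r) :: be)) ++ U).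
    by rewrite -cat_cons perm_cat2r perm_sym.
  rewrite IH.
  - rewrite (weight_push _ eb) map_blocks_cat /=; congr (_ * fock _ _ _ _ _ _).
    by have := perm_size eTU; rewrite /= !size_cat => ->.
  - by apply: (normal_push _ nb loc).
  - by rewrite -(perm_uniq eTU) /= mem_cat negb_or nkT nkU cat_uniq uT UT.
  - by rewrite -(perm_all _ eTU) /= kn.
rewrite (eq_big_seq _ G) big_split /=.
rewrite -big_mkcond /= big_const_seq iter_addr_0.
have -> : count (fun k => k \notin T ++ U) (iota 0 n) = (n - (size T + size U))%N.
  have c1 : count (mem (T ++ U)) (iota 0 n) = size (T ++ U).
    rewrite -size_filter; apply/perm_size/uniq_perm.
    - exact/filter_uniq/iota_uniq.
    - by rewrite cat_uniq uT UT.
    - move=> k; rewrite mem_filter mem_iota add0n /=.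
      by apply/andP/idP => [[]//|kTU]; split => //; apply: (allP lt_n).
  have := count_predC (mem (T ++ U)) (iota 0 n).
  rewrite c1 size_iota size_cat => e0; rewrite -{2}e0 addKn.
  by apply: eq_count => k /=.
have ewv : word_weight ((v, e) :: w) = set_weight v * word_weight w.
  by rewrite /word_weight big_cons.
rewrite mulrDr ewv; congr (_ + _).
  by rewrite /cP -mulr_natl; ring.
case: r Tmem loc eb @cP G => [_ _ _ _ _|x r Tmem loc eb _ _] /=.
  by rewrite big1 ?mulr0.
have xT := Tmem x r erefl.
have xn : x.2 \in iota 0 n.
  by rewrite mem_iota add0n; apply: (allP lt_n); rewrite mem_cat xT.
rewrite (bigD1_seq _ xn (iota_uniq _ _)) /= eqxx big1 => [|k]; last first.
  by rewrite eq_sym => /negPf->.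
rewrite addr0 andTb; case: ifP => _; last by rewrite mulr0.
rewrite /cQ map_blocks_cat map_add_block (weight_pop eb) s2E /set_weight -exprM mulnC exprM expr2.
by ring.
Qed.

Hypothesis b_law : forall (l : 'I_L) (k k' : nat) (p : {poly C}),
  tau (letter_val bv ((l, k), p)) = tau (letter_val bv ((l, k'), p)).

Definition relabel_item (f : nat -> nat) x : item := (x.1, (x.2.1, f x.2.2)).

Lemma tagged_map w f ks : tag_word w (map f ks) = map (relabel_item f) (tag_word w ks).
Proof. by rewrite /tag_word; elim: w ks => [|c w IH] [|k ks] //=; rewrite IH. Qed.

Lemma items_word_relabel f s : items_word (map (relabel_item f) s) =
  [seq ((c.1.1, f c.1.2), c.2) | c <- items_word s].
Proof.
elim: s => // x s IH; rewrite /= !items_word_cons map_cat IH; congr (_ ++ _).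
by rewrite /item_word -map_comp.
Qed.

Lemma mem_vertices_items (c : 'I_L * nat) s :
  c \in vertices (items_word s) -> c.2 \in tags s.
Proof.
rewrite vertices_items => /flattenP[_ /mapP[x xs ->]].
by rewrite vertices_item => /mapP[l _ ->]; apply: mem_tags.
Qed.

Lemma tau_items_relabel f s : {in tags s &, injective f} ->
  tau (items_val (map (relabel_item f) s)) = tau (items_val s).
Proof.
move=> fI; rewrite /items_val items_word_relabel.
rewrite (tau_relabel b_comm b_indep (f := fun c => (c.1, f c.2))) //.
  by move=> [l k] p; apply: b_law.
move=> [l k] [l' k'] /mem_vertices_items ks /mem_vertices_items ks' [-> e].
by have /= -> := fI _ _ ks ks' e.
Qed.

Lemma tags_rev s : tags (rev s) = rev (tags s).
Proof. by rewrite /tags map_rev. Qed.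

(** Replacing each tag by its index in [undup ks] keeps the moment and leaves finitely many tag
    sequences; [c] sums over all of these, uniformly in the original tags. *)
Lemma tau_tagged_bound w : exists2 c : C, 0 <= c &
  forall ks, size ks = size w -> `|tau (items_val (rev (tag_word w ks)))| <= c.
Proof.
exists (\sum_(p <- tag_seqs (size w) (size w)) `|tau (items_val (rev (tag_word w p)))|).
  by apply: sumr_ge0.
move=> ks sk; pose p := map (index^~ (undup ks)) ks.
have ep : map (nth 0%N (undup ks)) p = ks.
  rewrite -map_comp -[RHS]map_id; apply/eq_in_map => k kk /=.
  by rewrite nth_index ?mem_undup.
have lp j : j \in p -> (j < size (undup ks))%N.
  by move=> /mapP[k kk ->]; rewrite index_mem mem_undup.
have pm : p \in tag_seqs (size w) (size w).
  rewrite mem_tag_seqs size_map sk eqxx /=; apply/allP => j /lp jp.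
  by apply: leq_trans jp _; rewrite -sk size_undup.
rewrite -ep tagged_map -map_rev tau_items_relabel.
  rewrite (bigD1_seq _ pm (tag_seqs_uniq _ _)) /= lerDl.
  by apply: sumr_ge0.
move=> i j; rewrite tags_rev tags_tagged ?size_map // !mem_rev => ip jp /eqP.
by rewrite nth_uniq ?lp ?undup_uniq // => /eqP.
Qed.

Lemma tau_tagged_single w ks k : size ks = size w -> count_mem k ks = 1%N ->
  tau (items_val (rev (tag_word w ks))) = 0.
Proof.
move=> sk ck; have : k \in tags (rev (tag_word w ks)).
  by rewrite tags_rev tags_tagged // mem_rev -has_pred1 has_count ck.
case/mapP => x xs ek.
have : tag_count k (rev (tag_word w ks)) = 1%N.
  by rewrite /tag_count tags_rev tags_tagged // count_rev.
case/splitPr: xs => s t; rewrite tag_count_cat tag_count_cons -ek eqxx addnCA => /eqP.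
rewrite eqSS addn_eq0 => /andP[/eqP/tag_count0 ns /eqP/tag_count0 nt].
have /finset.set0Pn[l lx] := valP x.1.
apply: (tau_items_single lx) => y yst eyk.
by move: yst; rewrite mem_cat => /orP[] /mem_tags; rewrite eyk -ek ?(negPf ns) ?(negPf nt).
Qed.

Lemma tends_tagged w : tends
  (fun n => inv_root R n ^+ size w *
     \sum_(ks <- tag_seqs n (size w)) tau (items_val (rev (tag_word w ks))))
  (word_weight w * fock h complete_set (fun=> 1) 0 [::] w).
Proof.
have [->|w0] := eqVneq w [::].
  rewrite /word_weight big_nil /=.
  apply: (@tends_eventually _ 0 _ (fun=> 1 * 1%:R)); last exact: tends_cst.
  move=> n _; rewrite big_cons big_nil addr0 expr0 /tag_word /= /items_val /items_word /=.
  by rewrite word_val_nil tau1.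
have m0 : (0 < size w)%N by rewrite lt0n size_eq0.
have [c c0 bc] := tau_tagged_bound w.
(* The largest [d] with [d.*2 < size w]; by [few_tags] it bounds the number of distinct tags of a
   non-pairing in which no tag is single. *)
pose d := (size w).-1./2.
have dm : (d.*2 < size w)%N.
  by rewrite -(prednK m0) ltnS /d -{2}[(size w).-1]odd_double_half leq_addl.
pose rest n := \sum_(ks <- tag_seqs n (size w) | ~~ pairing ks)
    tau (items_val (rev (tag_word w ks))).
have split n : \sum_(ks <- tag_seqs n (size w)) tau (items_val (rev (tag_word w ks))) =
    word_weight w * fock h complete_set (fun j => (n - j)%:R) 0 [::] w + rest n.
  rewrite (bigID pairing) /=; congr (_ + _).
  have := @paired_sum_fock n [::] [::] w isT isT isT.
  rewrite /paired_sum /weight /flat /= big_nil mul1r => <-.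
  by apply: eq_bigr => ks _; rewrite cats0.
have rest_bound n : `|rest n| <= (c * (d ^ size w)%:R) * n%:R ^+ d.
  apply: (@le_trans _ _
      (\sum_(ks <- [seq ks <- tag_seqs n (size w) | (size (undup ks) <= d)%N]) c)).
    apply: le_trans (ler_norm_sum _ _ _) _.
    rewrite big_filter big_mkcond [leRHS]big_mkcond big_seq [leRHS]big_seq.
    apply: ler_sum => ks /size_mem_tag_seqs sk.
    case: (boolP (pairing ks)) => [_|np] /=; first by case: ifP.
    case: (boolP (all (fun k => count_mem k ks != 1%N) ks)) => [n1|/allPn[k _]].
      have := few_tags np n1; rewrite sk => lt.
      have -> : (size (undup ks) <= d)%N.
        by rewrite /d -(doubleK (size (undup ks))); apply: half_leq; rewrite -ltnS prednK.
      exact: bc.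
    rewrite negbK => /eqP/(tau_tagged_single sk) ->; rewrite normr0.
    by case: ifP.
  rewrite big_const_seq count_predT iter_addr_0 -(mulr_natr c) -mulrA ler_wpM2l //.
  rewrite -natrX -natrM ler_nat mulnC; exact: count_few_tags.
rewrite -[X in tends _ X]addr0.
apply: (@tends_eventually _ 0 _ (fun n => word_weight w * (inv_root R n ^+ size w * 1 *
    fock h complete_set (fun j => (n - j)%:R) 0 [::] w) + inv_root R n ^+ size w * rest n)).
  move=> n _; rewrite split mulrDr mulr1; congr (_ + _); exact: mulrCA.
apply: tendsD.
  apply: tendsM; first exact: tends_cst.
  exact: (@tends_fock R _ h complete_set (@product_edge_sym L g) (@product_edge_irr L g)
    w [::] 0 0 isT).
exact: tends_bounded_count dm rest_bound.
Qed.

End PairedSums.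

End Items.

(** * Wick polynomials *)

Lemma two_step_ind (T : Type) (P : seq T -> Prop) :
  P [::] -> (forall a, P [:: a]) -> (forall a b s, P s -> P (b :: s) -> P (a :: b :: s)) ->
  forall s, P s.
Proof.
move=> P0 P1 P2 s; suff [//] : P s /\ forall a, P (a :: s).
by elim: s => [|b s [Ps Pbs]]; split => // a; apply: P2.
Qed.

Section Wick.
Context {R : realType} (B : ncProbSpaceType R).
Local Notation C := R[i].
Implicit Types (x : B) (c e : bool) (r t : seq bool).

Definition star_pow x e : B := if e then star x else x.

(* The Wick polynomials of a semicircular (c = true, all letters contract) or circular
   (c = false, only different letters contract) variable. *)
Fixpoint wick x c r : B :=
  if r is e :: r' then
    star_pow x e * wick x c r' -
    (if r' is e' :: r'' then if c || (e != e') then wick x c r'' else 0 else 0)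
  else 1.

Lemma wick_cons x c e r : wick x c (e :: r) = star_pow x e * wick x c r -
    (if r is e' :: r' then if c || (e != e') then wick x c r' else 0 else 0).
Proof. by []. Qed.

Lemma wick_subalgebra (S : set B) x c r : star_subalgebra S -> S x -> S (wick x c r).
Proof.
case=> -[S1 SD SZ SM] Sst Sx; have Se e : S (star_pow x e) by case: e => //; apply: Sst.
have SN y : S y -> S (- y) by rewrite -scaleN1r; apply: SZ.
have S0 : S 0 by rewrite -(scale0r 1); apply: SZ.
elim/two_step_ind: r => // [e|e e' r Sr Ser].
  by rewrite /= subr0 mulr1.
rewrite wick_cons; apply: SD; first exact: SM.
by apply: SN; case: ifP.
Qed.

Lemma tau_add (x y : B) : tau (x + y) = tau x + tau y. Proof. exact: linearD. Qed.

Lemma tau_sub (x y : B) : tau (x - y) = tau x - tau y. Proof. exact: linearB. Qed.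

Lemma tau_scale (a : C) (x : B) : tau (a *: x) = a * tau x. Proof. exact: linearZ. Qed.

Section Joint.
Variables (V : finType) (h : graph V) (s : V -> B) (compl : pred V).
Hypothesis s_indep : graph_independent h (fun v => generated [set s v]).
Hypothesis tau_wick : forall v r, r != [::] -> tau (wick (s v) (compl v) r) = 0.

Definition wick_block (b : V * seq bool) : B := wick (s b.1) (compl b.1) b.2.
Definition wick_state bs : B := \prod_(b <- bs) wick_block b.

Lemma wick_state_add ab v r be : wick_state (ab ++ add_block v r be) =
  wick_state ab * (wick_block (v, r) * wick_state be).
Proof.
rewrite /wick_state big_cat /=; congr (_ * _); case: r => [|e r] /=; last by rewrite big_cons.
by rewrite /wick_block mul1r.
Qed.

Lemma star_pow_gen v e : generated [set s v] (star_pow (s v) e).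
Proof.
have [_ Gst] := generated_subalgebra [set s v].
have g1 : generated [set s v] (s v) by apply: generated_set1.
by case: e => //; exact: Gst.
Qed.

Lemma wick_block_gen b : generated [set s b.1] (wick_block b).
Proof. by apply: (wick_subalgebra _ _ (generated_subalgebra _)); apply: generated_set1. Qed.

Lemma wick_state_comm v e ab : all (fun b => h v b.1) ab ->
  star_pow (s v) e * wick_state ab = wick_state ab * star_pow (s v) e.
Proof.
have [hcom _] := s_indep.
elim: ab => [|b ab IH] /=; first by rewrite /wick_state big_nil mulr1 mul1r.
case/andP=> hvb /IH eab; rewrite /wick_state big_cons -/(wick_state ab) mulrA.
have [-> _] := hcom _ _ hvb _ _ (@star_pow_gen v e) (@wick_block_gen b).
by rewrite -mulrA eab mulrA.
Qed.

Lemma tau_wick_state bs : normal h bs -> tau (wick_state bs) = (bs == [::])%:R.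
Proof.
move=> /andP[ne rb]; case: eqP => [->|/eqP bs0].
  by rewrite /wick_state big_nil tau1.
have -> : wick_state bs = \prod_(y <- [seq (b.1, wick_block b) | b <- bs]) y.2.
  by rewrite /wick_state big_map.
apply: (graph_independent_seq s_indep).
- by rewrite -size_eq0 size_map size_eq0.
- by rewrite -map_comp.
- move=> _ /mapP[b bbs ->] /=; split; first exact: (@wick_block_gen b).
  by apply: tau_wick; apply: (allP ne).
Qed.

(** A letter multiplied on the left of a Wick state commutes past [ab] to its block, where the
    recursion of [wick] yields the created state plus the annihilated one. The counter [n] is free
    because creations have weight 1. *)
Lemma tau_word_fock w bs n : normal h bs ->
  tau ((\prod_(y <- rev w) star_pow (s y.1) y.2) * wick_state bs) =
  fock h compl (fun=> 1) n bs w.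
Proof.
elim: w bs n => [|[v e] w IH] bs n nb /=.
  by rewrite big_nil mul1r tau_wick_state.
case loc: (locate h v bs) => [[ab r] be]; have [eb hab _ _] := locateP nb loc.
rewrite rev_cons -cats1 big_cat /= big_seq1 -mulrA mul1r.
have -> : star_pow (s v) e * wick_state bs = wick_state (ab ++ (v, e :: r) :: be) +
    (if r is e' :: r' then
       if matches compl v e e' then wick_state (ab ++ add_block v r' be) else 0 else 0).
  rewrite {1}eb wick_state_add mulrA (wick_state_comm e hab) -mulrA.
  rewrite -[(v, e :: r) :: be]/(add_block v (e :: r) be) wick_state_add.
  rewrite {2}/wick_block wick_cons mulrBl mulrBr -!mulrA -[LHS]addr0 -addrA; congr (_ + _).
  apply/esym/eqP; rewrite addrC subr_eq0; apply/eqP.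
  case: r {loc eb} => [|e' r]; first by rewrite mul0r mulr0.
  by rewrite /matches; case: ifP => _; rewrite ?mul0r ?mulr0 // wick_state_add.
rewrite mulrDr tau_add (IH _ n.+1); last exact: normal_push nb loc.
congr (_ + _); case: r loc {eb} => [|e' r] loc; first by rewrite mulr0 linear0.
case: ifP => _; last by rewrite mulr0 linear0.
by apply: IH; apply: (normal_pop _ _ nb loc); [exact: edge_sym|exact: edge_irr].
Qed.

End Joint.
End Wick.

(** The prefix [t] absorbs the letters unfolded from [wick], so that the induction ends in plain
    star moments. *)
Lemma tau_wick_law (R : realType) (A B : ncProbSpaceType R) (x : A) (y : B) c r t :
  same_star_law x y ->
  tau (star_word x t * wick x c r) = tau (star_word y t * wick y c r).
Proof.
move=> xy; elim/two_step_ind: r t => [t|e t|e e' r IHr IHer t].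
- by rewrite !mulr1; exact: xy.
- by rewrite /= !subr0 !mulr1; have := xy (rcons t e); rewrite /star_moment /star_word !big_rcons.
- have sw (D : ncProbSpaceType R) (z : D) : star_word z t * star_pow z e = star_word z (rcons t e).
    by rewrite /star_word -cats1 big_cat /= big_seq1.
  have E (D : ncProbSpaceType R) (z : D) : star_word z t * wick z c [:: e, e' & r] =
      star_word z (rcons t e) * wick z c (e' :: r) -
      (if c || (e != e') then star_word z t * wick z c r else 0).
    rewrite wick_cons [LHS]mulrBr mulrA sw; congr (_ - _).
    by case: ifP => // _; rewrite mulr0.
  rewrite !E !tau_sub IHer; congr (_ - _).
  by case: ifP => // _; rewrite !linear0.
Qed.

(** * Catalan numbers as path counts *)

Section Semicircle.
Local Open Scope nat_scope.

(** Nonnegative lattice paths with [m] steps of plus or minus 1 from height [j] to height 0. *)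
Fixpoint paths (m j : nat) : nat :=
  if m is m'.+1 then paths m' j.+1 + (if j is j'.+1 then paths m' j' else 0)
  else j == 0.

Lemma paths_odd m j : odd (m + j) -> paths m j = 0.
Proof.
elim: m j => [|m IH] [|j] //= o; rewrite ?IH //.
- by rewrite addn1 -(addn0 m).
- by move: o; rewrite addnS /= negbK.
- by rewrite !addnS /= negbK; move: o; rewrite addnS /= negbK.
Qed.

Lemma paths_lt m j : m < j -> paths m j = 0.
Proof.
elim: m j => [|m IH] [|j] //= mj; rewrite !IH //; lia.
Qed.

(** The ballot numbers 'C(m, i) - 'C(m, i - 1), written as a sum to avoid truncated subtraction; [i]
    counts the up steps. *)
Lemma paths_ballot m i j : j + i.*2 = m ->
  paths m j + (if i is i'.+1 then 'C(m, i') else 0) = 'C(m, i).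
Proof.
elim: m i j => [|m IH] [|i] [|j] //= em.
- have jm : j + 0.*2 = m by lia.
  by have := IH 0 j jm; rewrite (@paths_lt m j.+2) ?bin0; lia.
- have im : 1 + i.*2 = m by lia.
  have := IH i 1 im; rewrite binS -(@bin_sub m i.+1); last by lia.
  have -> : m - i.+1 = i by lia.
  by case: i {em im} => [|i]; rewrite ?binS ?bin0; lia.
- have im1 : j + i.+1.*2 = m by lia.
  have im2 : j.+2 + i.*2 = m by lia.
  have := IH i.+1 j im1; have := IH i j.+2 im2; rewrite binS.
  by case: i {em im1 im2} => [|i]; rewrite ?binS ?bin0; lia.
Qed.

Lemma paths_semicircle m : paths m 0 = semicircle_moment m.
Proof.
rewrite /semicircle_moment; case: ifP => [om|em]; first by apply: paths_odd; rewrite addn0.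
have e2 : (m./2).*2 = m by rewrite -{2}(odd_double_half m) em.
have := @paths_ballot m m./2 0 e2; move: (m./2) e2 => i <-; case: i => [|i].
  by rewrite addn0 => ->; rewrite bin0 divn1.
(* From (i + 1) c = (i + 2) c' and the ballot identity paths + c' = c follows c = (i + 2) paths, so
   the division in the Catalan number is exact. *)
have := mul_bin_left i.+1.*2 i; set c := 'C(_, i.+1); set c' := 'C(_, i).
have -> : i.+1.*2 - i = i.+2 by lia.
move=> e1 e3; have -> : c = paths i.+1.*2 0 * i.+2 by nia.
by rewrite mulnK.
Qed.

End Semicircle.

Lemma conj_realC (R : realType) (x : R) : Num.conj (x%:C : R[i]) = x%:C.
Proof. by apply: conj_Creal; apply/complex_realP; exists x. Qed.

(** * Centering of semicircular and circular Wick polynomials *)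

Section WickMoments.
Context {R : realType}.
Local Notation C := R[i].

Lemma tau_wick_semicircular (B : ncProbSpaceType R) (x : B) r :
  semicircular x -> r != [::] -> tau (wick x true r) = 0.
Proof.
case=> x_sa x_mom r0; have xe e : star_pow x e = x by case: e => //; exact: x_sa.
(* For self-adjoint [x] these are the Chebyshev polynomials U_n(x/2); their three-term recursion is
   that of [paths]. The factor [x ^+ m] makes the induction work, and [paths 0 j] vanishes for
   positive [j]. *)
have key m : tau (x ^+ m * wick x true r) = (paths m (size r))%:R.
  elim/two_step_ind: r m {r0} => [m|e m|e e' r IHr IHer m].
  - by rewrite mulr1 x_mom paths_semicircle.
  - by rewrite /= subr0 mulr1 xe -exprSr x_mom -paths_semicircle /= addn0.
  - have -> : x ^+ m * wick x true [:: e, e' & r] =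
        x ^+ m.+1 * wick x true (e' :: r) - x ^+ m * wick x true r.
      by rewrite wick_cons [LHS]mulrBr mulrA xe exprSr.
    by rewrite tau_sub IHr IHer /= natrD addrK.
have := key 0%N; rewrite mul1r => ->.
by case: (r) r0.
Qed.

Section Circular.
Variables (B : ncProbSpaceType R) (s s' : B).
Hypothesis s_semi : semicircular s.
Hypothesis s'_semi : semicircular s'.
Hypothesis s_free : freely_independent (fun b : bool => generated [set if b then s else s']).
Definition sb (b : bool) : B := if b then s else s'.

Fixpoint free_wick (d : seq bool) : B :=
  if d is b :: d' then
    sb b * free_wick d' - (if d' is b' :: d'' then if b == b' then free_wick d'' else 0 else 0)
  else 1.

Lemma free_wick_cons b d : free_wick (b :: d) = sb b * free_wick d -
  (if d is b' :: d' then if b == b' then free_wick d' else 0 else 0).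
Proof. by []. Qed.

(** Contractions occur only between equal neighbours, so a run of equal letters splits off as a
    one-variable Wick polynomial; its flags [false] are mere padding, as all letters of a
    semicircular variable contract. *)
Lemma free_wick_run b (k : nat) d : (if d is b' :: _ then b != b' else true) ->
  free_wick (nseq k b ++ d) = wick (sb b) true (nseq k false) * free_wick d.
Proof.
move=> hd; suff [] : free_wick (nseq k b ++ d) = wick (sb b) true (nseq k false) * free_wick d /\
    free_wick (nseq k.+1 b ++ d) = wick (sb b) true (nseq k.+1 false) * free_wick d by [].
elim: k => [|k [IH1 IH2]].
  split; first by rewrite mul1r.
  rewrite [LHS]free_wick_cons /= subr0 mulr1.
  by case: d hd => [|b' d] /=; [rewrite subr0|move=> /negPf ->; rewrite subr0].
split=> //; rewrite -[free_wick (nseq k.+2 b ++ d)]/(sb b * free_wick (nseq k.+1 b ++ d) -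
  (if b == b then free_wick (nseq k b ++ d) else 0)) eqxx IH1 IH2.
have -> : wick (sb b) true (nseq k.+2 false) =
  sb b * wick (sb b) true (nseq k.+1 false) - wick (sb b) true (nseq k false) by [].
by rewrite [RHS]mulrBl -[in RHS]mulrA.
Qed.

(** The maximal runs of [d] alternate between [s] and [s'] and give centered factors, so freeness
    applies. *)
Lemma tau_free_wick d : d != [::] -> tau (free_wick d) = 0.
Proof.
move=> d0.
have [rs [ed srt pos]] : exists rs : seq (bool * nat), [/\
    d = flatten [seq nseq y.2 y.1 | y <- rs], sorted (fun a b => a != b) [seq y.1 | y <- rs] &
    all (fun y => 0 < y.2)%N rs].
  elim: d {d0} => [|b d [rs [-> srt pos]]]; first by exists [::].
  case: rs srt pos => [|[b' k] rs] srt pos; first by exists [:: (b, 1%N)].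
  have [ebb|nbb] := eqVneq b b'; last first.
    exists [:: (b, 1%N), (b', k) & rs]; split=> [//||]; last exact: pos.
    by rewrite -[sorted _ _]/((b != b') &&
      sorted (fun a b => a != b) [seq y.1 | y <- (b', k) :: rs]) nbb.
  subst b'; exists ((b, k.+1) :: rs); split=> [//||]; first exact: srt.
  by case/andP: pos.
have -> : free_wick d = \prod_(y <- [seq (y.1, wick (sb y.1) true (nseq y.2 false)) | y <- rs]) y.2.
  rewrite ed big_map; elim: rs srt pos {ed d0} => [|[b k] rs IH] srt pos; first by rewrite big_nil.
  rewrite big_cons -IH; last 2 first.
  - by case: (rs) srt => //= y rs' /andP[].
  - by case/andP: pos.
  apply: free_wick_run; case: rs srt pos {IH} => //= -[b' [|k']] rs /andP[nb _] //.
  by case/andP.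
apply: (freely_independent_seq s_free).
- by case: (rs) ed d0 => // ->.
- by rewrite -map_comp.
- move=> _ /mapP[y yrs ->] /=; split.
    by apply: (wick_subalgebra _ _ (generated_subalgebra _)); apply: generated_set1.
  apply: tau_wick_semicircular; first by case: (y.1).
  by move/allP: pos => /(_ y yrs); case: y.2.
Qed.

Definition circ_coef (e b : bool) : C :=
  ((Num.sqrt 2)^-1 : R)%:C * (if b then 1 else if e then - 'i else 'i).

Definition circ : B := ((Num.sqrt 2)^-1 : R)%:C *: (s + ('i : C) *: s').

Lemma star_pow_circ e :
  star_pow circ e = circ_coef e true *: s + circ_coef e false *: s'.
Proof.
have [ss _] := s_semi; have [ss' _] := s'_semi.
case: e; rewrite /star_pow /circ /circ_coef; last first.
  by rewrite mulr1 scalerDr scalerA.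
rewrite starZ starD starZ ss ss' scalerDr scalerA mulr1; congr (_ *: _ + (_ * _) *: _).
- by rewrite conj_realC.
- by rewrite conj_realC.
- by rewrite conjCi.
Qed.

(** The covariance of [circ] and its adjoint: equal letters have covariance 0, different ones 1. *)
Lemma circ_coef_sum e e' :
  circ_coef e true * circ_coef e' true + circ_coef e false * circ_coef e' false = (e != e')%:R.
Proof.
have c2 : ((Num.sqrt 2)^-1 : R)%:C ^+ 2 * 2 = 1 :> C.
  rewrite -(rmorph_nat (real_complex R)) -rmorphXn -rmorphM /= exprVn sqr_sqrtr ?ler0n //.
  by rewrite mulVf // pnatr_eq0.
rewrite /circ_coef !mulr1 [X in _ + X]mulrACA -expr2 -[X in X + _]mulr1 -mulrDr.
by case: e e' => -[] /=; rewrite ?(mulrNN, mulrN, mulNr) -expr2 sqrCi ?opprK ?subrr ?mulr0.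
Qed.

(* The linear extension of F to the expansion of the word r in circ and its adjoint as
   a combination of words in s (true) and s' (false). *)
Fixpoint expand r (F : seq bool -> B) : B :=
  if r is e :: r' then
    circ_coef e true *: expand r' (fun d => F (true :: d)) +
    circ_coef e false *: expand r' (fun d => F (false :: d))
  else F [::].

Lemma eq_expand r F G : F =1 G -> expand r F = expand r G.
Proof.
elim: r F G => /= [|e r IH] F G FG; first exact: FG.
by congr (_ *: _ + _ *: _); apply: IH => d; apply: FG.
Qed.

Lemma expandB r F G : expand r (fun d => F d - G d) = expand r F - expand r G.
Proof. by elim: r F G => //= e r IH F G; rewrite !IH !scalerBr addrACA opprD. Qed.

Lemma expandM r b F : expand r (fun d => b * F d) = b * expand r F.
Proof. by elim: r F => //= e r IH F; rewrite !IH !scalerAr -mulrDr. Qed.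

Lemma expand0 r : expand r (fun=> 0) = 0.
Proof. by elim: r => //= e r ->; rewrite !scaler0 addr0. Qed.

Lemma tau_expand r F : (forall d, size d = size r -> tau (F d) = 0) ->
  tau (expand r F) = 0.
Proof.
elim: r F => [|e r IH] F F0 /=; first exact: F0.
by rewrite tau_add !tau_scale !IH ?mulr0 ?addr0 // => d sd; apply: F0; rewrite /= sd.
Qed.

(** The contraction of equal letters in [free_wick], summed over both choices of letter with their
    coefficients, becomes by [circ_coef_sum] the contraction of different letters in [wick]. *)
Lemma wick_circ r : wick circ false r = expand r free_wick.
Proof.
elim/two_step_ind: r => [//|e|e e' r IHr IHer].
  by rewrite wick_cons star_pow_circ /= !subr0 !mulr1.
rewrite wick_cons IHer star_pow_circ mulrDl -!scalerAl -!expandM.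
have E b : expand (e' :: r) (fun d => sb b * free_wick d) =
    expand (e' :: r) (fun d => free_wick (b :: d)) + circ_coef e' b *: expand r free_wick.
  have -> : circ_coef e' b *: expand r free_wick = expand (e' :: r)
      (fun d => if d is b' :: d' then if b == b' then free_wick d' else 0 else 0).
    by case: b; rewrite /= expand0 scaler0 ?addr0 ?add0r.
  apply/eqP; rewrite -subr_eq -expandB; apply/eqP; apply: eq_expand => d.
  by rewrite free_wick_cons.
rewrite -[expand [:: e, e' & r] free_wick]/(
  circ_coef e true *: expand (e' :: r) (fun d => free_wick (true :: d)) +
  circ_coef e false *: expand (e' :: r) (fun d => free_wick (false :: d))).
rewrite -[s]/(sb true) -[s']/(sb false) !E -IHr.
move: (expand _ _) (expand _ _) (wick _ _ _) => x y z.
rewrite !scalerDr addrACA !scalerA -scalerDl circ_coef_sum.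
by case: eqP => _ /=; rewrite ?scale1r ?scale0r ?addr0 ?subr0 // addrK.
Qed.

Lemma tau_wick_circ r : r != [::] -> tau (wick circ false r) = 0.
Proof.
move=> r0; rewrite wick_circ; apply: tau_expand => d sd; apply: tau_free_wick.
by rewrite -size_eq0 sd size_eq0.
Qed.

End Circular.

Lemma tau_wick_circular (B : ncProbSpaceType R) (x : B) r :
  circular x -> r != [::] -> tau (wick x false r) = 0.
Proof.
move=> [B' [s [s' [semi semi' free law]]]] r0.
have := tau_wick_law false r [::] law.
by rewrite /star_word !big_nil !mul1r => ->; apply: tau_wick_circ.
Qed.

End WickMoments.

(** * Expansion of star moments of linear combinations *)

Section StarAlgebraFacts.
Context {R : realType} (A : ncProbSpaceType R).
Local Notation C := R[i].
Implicit Types x y : A.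

Lemma star1 : star (1 : A) = 1.
Proof.
have := starM (1 : A) (star 1); rewrite mul1r starK => e.
by rewrite [RHS]e mul1r.
Qed.

Lemma star0 : star (0 : A) = 0.
Proof. by rewrite -(scale0r (0 : A)) starZ conjC0 !scale0r. Qed.

Lemma star_sum (I : Type) (r : seq I) (F : I -> A) :
  star (\sum_(i <- r) F i) = \sum_(i <- r) star (F i).
Proof. exact: (big_morph _ (@starD R A) star0). Qed.

Lemma star_pow_scale_sum (I : Type) (r : seq I) (c : I -> C) (F : I -> A) e :
  (forall i, Num.conj (c i) = c i) ->
  star_pow (\sum_(i <- r) c i *: F i) e = \sum_(i <- r) c i *: star_pow (F i) e.
Proof.
case: e => //= cr; rewrite star_sum; apply: eq_bigr => i _.
by rewrite starZ cr.
Qed.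

Lemma star_wordE x t : star_word x t = \prod_(e <- t) star_pow x e.
Proof. by []. Qed.

Fixpoint choice_words (I : finType) (t : seq bool) : seq (seq (I * bool)) :=
  if t is e :: t' then
    [seq (i, e) :: w | i <- index_enum I, w <- choice_words I t']
  else [:: [::]].

Lemma star_word_sum (I : finType) (c : I -> C) (F : I -> A) t :
  (forall i, Num.conj (c i) = c i) ->
  star_word (\sum_i c i *: F i) t = \sum_(w <- choice_words I t)
    (\prod_(y <- w) c y.1) *: \prod_(y <- w) star_pow (F y.1) y.2.
Proof.
move=> cr; rewrite star_wordE; elim: t => [|e t IH].
  by rewrite big_nil /= big_seq1 !big_nil scale1r.
rewrite big_cons IH star_pow_scale_sum // mulr_suml big_allpairs_dep.
apply: eq_bigr => i _; rewrite mulr_sumr; apply: eq_bigr => w _.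
by rewrite !big_cons -scalerAl -scalerAr scalerA.
Qed.

Lemma tau_horner_law (x y : A) p : same_star_law x y ->
  tau (horner_alg x p) = tau (horner_alg y p).
Proof.
move=> xy; suff key n : tau (horner_alg x p * x ^+ n) = tau (horner_alg y p * y ^+ n).
  by have := key 0%N; rewrite !mulr1.
elim/poly_ind: p n => [|p c IH] n; first by rewrite !rmorph0 !mul0r.
rewrite !rmorphD !rmorphM /= !horner_algX !horner_algC !mulrDl -!mulrA -!exprS.
rewrite !linearD /= IH; congr (_ + _); rewrite -!scalerAl !mul1r !linearZ /=.
have pw z : star_word z (nseq n false) = z ^+ n.
  by rewrite /star_word; elim: n {IH} => [|n IH] /=; rewrite ?big_nil // big_cons IH exprS.
by congr (_ * _); rewrite -!pw; exact: xy.
Qed.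

Lemma prod_if_scalar (I : Type) (r : seq I) (P : pred I) (F : I -> A) (c : C) :
  \prod_(i <- r) (if P i then F i else c%:A) =
  (\prod_(i <- r | ~~ P i) c) *: \prod_(i <- r | P i) F i.
Proof.
elim: r => [|i r IH]; first by rewrite !big_nil scale1r.
rewrite !big_cons IH; case: (P i) => /=; first by rewrite scalerAr.
by rewrite -scalerAl mul1r scalerA.
Qed.

End StarAlgebraFacts.

(** * Expansion of the normalized sums *)

Section Expansion.
Context {R : realType} (A : ncProbSpaceType R) (L : nat).
Variables (b : 'I_L -> nat -> A) (lambda : R).
Local Notation C := R[i].
Local Notation lam := (lambda%:C : C).
Local Notation VJ := (nonempty_subset L).
Hypothesis b_sa : forall l k, star (b l k) = b l k.
Local Notation bv := (fun x : 'I_L * nat => b x.1 x.2).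
Local Notation item_val x := (word_val bv (item_word lam x)).

Lemma center_val l k : letter_val bv ((l, k), center_poly lam) = b l k - lam%:A.
Proof. by rewrite /letter_val /center_poly rmorphB /= horner_algX horner_algC. Qed.

Lemma star_item J k : star (item_val (J, (false, k))) = item_val (J, (true, k)).
Proof.
rewrite /item_word /item_support /=; elim: (enum _) => [|l s IH] /=.
  by rewrite word_val_nil star1.
rewrite word_val_cons starM IH rev_cons map_rcons -cats1 word_val_cat.
congr (_ * _); rewrite word_val_cons word_val_nil mulr1 center_val starD b_sa.
by rewrite -scaleN1r !starZ star1 conj_realC -(rmorphN1 (real_complex R)) conj_realC.
Qed.

Lemma star_pow_item J k e : star_pow (item_val (J, (false, k))) e = item_val (J, (e, k)).
Proof. by case: e => //; exact: star_item. Qed.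

Definition subset_weight (J : {set 'I_L}) : C := (lambda ^+ #|finset.setC J|)%:C.

Lemma prod_expand k :
  \prod_(l < L) b l k - (lambda ^+ L)%:C%:A =
  \sum_(J : VJ) subset_weight (val J) *: item_val (J, (false, k)).
Proof.
have -> : \prod_(l < L) b l k = \prod_(l < L) ((b l k - lam%:A) + lam%:A).
  by apply: eq_bigr => l _; rewrite subrK.
rewrite bigA_distr.
have E (J : {set 'I_L}) : \prod_(l < L) (if l \in J then b l k - lam%:A else lam%:A) =
    subset_weight J *: \prod_(l in J) (b l k - lam%:A).
  rewrite prod_if_scalar; congr (_ *: _).
  rewrite /subset_weight rmorphXn /= -prodr_const; apply: eq_bigl => l.
  by rewrite finset.in_setC.
(* The term of the empty set is [lambda ^+ L] and cancels the subtracted scalar; the other sets are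
   reindexed by [VJ]. *)
rewrite (eq_bigr _ (fun J _ => E J)) (bigD1 finset.set0) //=.
rewrite big_set0 {1}/subset_weight finset.setC0 cardsT card_ord addrAC subrr add0r.
rewrite (reindex_omap (val : VJ -> {set 'I_L}) insub) /=; last first.
  by move=> J J0; rewrite insubT.
apply: eq_big => [J|J _]; first by rewrite valK eqxx (valP J).
congr (_ *: _); rewrite /item_word /item_support /= /word_val big_map.
rewrite -deprecated_filter_index_enum big_filter.
by apply: eq_bigr => l _; rewrite center_val.
Qed.

Definition normalized_sum (n : nat) (J : VJ) : A :=
  inv_root R n *: \sum_(k <- iota 0 n) item_val (J, (false, k)).

Lemma clt_sum_expand (a_ : 'I_L -> nat -> A) n : (forall l k, a_ l k.+1 = b l k) ->
  tensor_clt_sum a_ lambda n = \sum_(J : VJ) subset_weight (val J) *: normalized_sum n J.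
Proof.
move=> ab; rewrite /tensor_clt_sum big_add1 /= /index_iota subn0 scaler_sumr.
under eq_bigr => k _.
  under eq_bigr => l _ do rewrite ab.
  rewrite prod_expand scaler_sumr.
  over.
rewrite exchange_big; apply: eq_bigr => J _.
rewrite /normalized_sum scalerA mulrC -scalerA !scaler_sumr; apply: eq_bigr => k _.
by rewrite !scalerA.
Qed.

Lemma star_pow_normalized n J e : star_pow (normalized_sum n J) e =
  inv_root R n *: \sum_(k <- iota 0 n) item_val (J, (e, k)).
Proof.
rewrite /normalized_sum !scaler_sumr star_pow_scale_sum => [|k]; last exact: conj_realC.
by apply: eq_bigr => k _; rewrite star_pow_item.
Qed.

Lemma prod_normalized n (w : seq (VJ * bool)) :
  \prod_(y <- w) star_pow (normalized_sum n y.1) y.2 =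
  inv_root R n ^+ size w *:
    \sum_(ks <- tag_seqs n (size w)) items_val b lam (tag_word w ks).
Proof.
elim: w => [|[J e] w IH].
  by rewrite big_nil /= big_seq1 /items_val /items_word /= word_val_nil scale1r.
rewrite big_cons IH star_pow_normalized /= -scalerAl -scalerAr scalerA exprS; congr (_ *: _).
rewrite mulr_suml big_allpairs_dep; apply: eq_bigr => k _; rewrite mulr_sumr.
by apply: eq_bigr => ks _; rewrite /tag_word /= items_val_cons.
Qed.

End Expansion.

(** * Comparison of both sides *)

Lemma perm_rev_tag_seqs n m : perm_eq (map rev (tag_seqs n m)) (tag_seqs n m).
Proof.
apply: uniq_perm; rewrite ?tag_seqs_uniq //.
  by rewrite map_inj_uniq ?tag_seqs_uniq //; exact: can_inj revK.
move=> ks; rewrite -{1}(revK ks) mem_map; last exact: can_inj revK.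
by rewrite !mem_tag_seqs size_rev all_rev.
Qed.

Lemma tagged_rev (L : nat) (w : seq (nonempty_subset L * bool)) ks :
  size ks = size w -> tag_word (rev w) (rev ks) = rev (tag_word w ks).
Proof. by move=> sk; rewrite /tag_word -rev_zip // map_rev. Qed.

Theorem corollary1p4 (R : realType) (L : nat) (hL : (0 < L)%N)
  (g : graph 'I_L)
  (A : ncProbSpaceType R) (A_ : 'I_L -> set A)
  (hA_sub : forall l, subalgebra (A_ l))
  (hA_indep : graph_independent g A_)
  (a : A) (lambda sigma : R)
  (ha_sa : self_adjoint a)
  (ha_mean : nc_mean a = lambda%:C)
  (ha_var : nc_variance a = (sigma ^+ 2)%:C)
  (a_ : 'I_L -> nat -> A)
  (ha_mem : forall l n, (0 < n)%N -> A_ l (a_ l n))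
  (ha_sa_ : forall l n, (0 < n)%N -> self_adjoint (a_ l n))
  (ha_law : forall l n, (0 < n)%N -> same_star_law (a_ l n) a)
  (ha_free : forall l, freely_independent
     (fun n : {n : nat | (0 < n)%N} => generated [set a_ l (val n)]))
  (B : ncProbSpaceType R) (s : nonempty_subset L -> B)
  (hs_semicircular : forall J, induced_complete g (val J) -> semicircular (s J))
  (hs_circular : forall J, ~ induced_complete g (val J) -> circular (s J))
  (hs_indep : graph_independent (product_graph g)
     (fun J => generated [set s J])) :
  cvg_star_moments (tensor_clt_sum a_ lambda) (clt_limit lambda sigma s).
Proof.
(* The copies are numbered from 1, the tags from 0. *)
pose b l k := a_ l k.+1; pose lam : R[i] := lambda%:C; pose sg : R[i] := sigma%:C.
have b_mem l k : A_ l (b l k) by apply: ha_mem.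
have b_free l : freely_independent (fun k => generated [set b l k]).
  move=> k i x k0 alt ix.
  apply: (@ha_free l k (fun j => exist _ (i j).+1 (ltn0Sn (i j))) x k0) => // j1 j2 j12 e.
  by apply: (alt j1 j2 j12); case: e.
have b_law l k p : tau (letter_val (fun x => b x.1 x.2) ((l, k), p)) = tau (horner_alg a p).
  by apply: tau_horner_law; apply: ha_law.
have b_mean l k : centered (fun x => b x.1 x.2) ((l, k), center_poly lam).
  rewrite /centered b_law /center_poly rmorphB /= horner_algX horner_algC.
  by rewrite linearB linearZ /= tau1 mulr1 -[tau a]/(nc_mean a) ha_mean subrr.
have b_var l k : tau (letter_val (fun x => b x.1 x.2)
    ((l, k), center_poly lam * center_poly lam)) = sg ^+ 2.
  rewrite b_law /center_poly rmorphM rmorphB /= horner_algX horner_algC.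
  rewrite mulrBl !mulrBr -!scalerAl -!scalerAr !mul1r !mulr1 !linearB !linearZ /= tau1.
  rewrite -[tau a]/(nc_mean a) ha_mean opprK -/lam /GRing.scale /= mulr1 mulrN addNr addr0.
  rewrite /sg -rmorphXn /= -ha_var /nc_variance -[tau a]/(nc_mean a) ha_mean.
  by rewrite !expr2.
have b_sa l k : star (b l k) = b l k by apply: ha_sa_.
have tau_wickE J r : r != [::] -> tau (wick (s J) (complete_set g J) r) = 0.
  have cP : reflect (induced_complete g (val J)) (complete_set g J).
    apply: (iffP 'forall_implyP) => [gJ i j iJ jJ nij|gJ i iJ].
      by have /'forall_implyP/(_ j jJ)/implyP := gJ i iJ; apply.
    by apply/'forall_implyP => j jJ; apply/implyP; apply: gJ.
  case: cP => [/hs_semicircular|/hs_circular]; first exact: tau_wick_semicircular.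
  exact: tau_wick_circular.
move=> t.
have moment_n n : star_moment (tensor_clt_sum a_ lambda n) t =
    \sum_(w <- choice_words (nonempty_subset L) t)
      (\prod_(y <- w) subset_weight lambda (val y.1)) * (inv_root R n ^+ size w *
        \sum_(ks <- tag_seqs n (size w)) tau (items_val b lam (rev (tag_word (rev w) ks)))).
  rewrite /star_moment (@clt_sum_expand _ _ _ b) // star_word_sum => [|J]; last exact: conj_realC.
  rewrite linear_sum; apply: eq_bigr => w _; rewrite linearZ /=; congr (_ * _).
  rewrite prod_normalized // linearZ /= linear_sum; congr (_ * _).
  (* Reversal permutes the tag sequences, so the word may be read from its right end as
     [tends_tagged] requires. *)
  rewrite -(perm_big _ (perm_rev_tag_seqs n (size w))) big_map /= big_seq [RHS]big_seq.
  by apply: eq_bigr => ks /size_mem_tag_seqs sk; rewrite -{1}(revK w) tagged_rev ?size_rev.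
have moment_lim : star_moment (clt_limit lambda sigma s) t =
    \sum_(w <- choice_words (nonempty_subset L) t)
      (\prod_(y <- w) subset_weight lambda (val y.1)) *
        (word_weight sg (rev w) *
           fock (@product_edge L g) (complete_set g) (fun=> 1) 0 [::] (rev w)).
  rewrite /star_moment star_word_sum => [|J]; last exact: conj_realC.
  rewrite linear_sum; apply: eq_bigr => w _; rewrite linearZ /= mulrA; congr (_ * _).
    rewrite /word_weight big_rev -big_split /=; apply: eq_bigr => y _.
    by rewrite rmorphM /= /set_weight /sg -rmorphXn.
  have := @tau_word_fock _ _ _ (product_graph g) s (complete_set g) hs_indep tau_wickE
    (rev w) [::] 0 isT.
  by rewrite revK /wick_state big_nil mulr1.
(* Both moments are now finite sums over the same words with the same coefficients, so the limit is
   taken word by word. *)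
rewrite moment_lim.
apply: (@tends_eventually R 0 _ _ _ (fun n _ => moment_n n)).
apply: tends_sum => w _; apply: tendsM; first exact: tends_cst.
have := @tends_tagged R A L g b lam (sg ^+ 2) (copy_comm hA_indep b_mem)
  (copies_indep hA_sub hA_indep b_mem b_free) b_mean b_var sg erefl _ (rev w).
by rewrite size_rev; apply => l k k' p; rewrite !b_law.
Qed.
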